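(* Any element $x_0^0\in I$ with a ternary representation consisting of finitely many $c$'s and infinitely many $l$'s and $r$'s constitutes the first element in a compatible sequence of initial basepoints giving rise to a compatible sequence of periodic orbits (in the direction $\pi/3$) that is eventually constant.
   Context: Let $KS_0=\Delta$ be the equilateral triangle of side length $1$ with base $I=[0,1]$. For $n\ge 0$, $KS_{n+1}$ is obtained from the polygon $KS_n$ by removing the open middle third of each of its $3\cdot 4^n$ sides and replacing it by the two other sides of the equilateral triangle erected on it, pointing outward. $\Omega(KS_n)$ is the compact region bounded by $KS_n$. Ternary representations are written with characters $l,c,r$ (left, center, right), standing for the ternary digits $0,1,2$ respectively; ''infinitely many $l$'s and $r$'s'' means infinitely many $l$'s and infinitely many $r$'s. The billiard map $f_n$ on $(KS_n\times S^1)/\sim$ sends a boundary point with inward pointing direction $(x,\theta)$ to $(x^1,\theta^1)$, where $x^1$ is the first point of $KS_n$ hit by the ray from $x$ in direction $\theta$ and $\theta^1$ is the inward direction obtained by reflecting $\theta$ in the side containing $x^1$. The orbit $\mathscr{O}_n(x_n^0,\theta_n^0)$ is the collection of points $f_n^k(x_n^0,\theta_n^0)$. An orbit is periodic if it is closed and does not hit a vertex of $KS_n$. Angles are measured in a fixed coordinate system placed at the base of $KS_0$. A sequence $\{x_i^0\}_{i\ge 0}$ with $x_i^0\in KS_i$ is a compatible sequence of initial basepoints in the direction $\theta$ if for every $n$, $x_n^0$ is collinear with $x_0^0$ in the direction $\theta$, with no points of $KS_n$ between $x_n^0$ and $x_0^0$ (and $\theta$ is inward pointing at each $x_n^0$);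 the corresponding orbits $\{\mathscr{O}_i(x_i^0,\theta)\}_{i\ge0}$ of $\Omega(KS_i)$ form a compatible sequence of orbits, called a compatible sequence of periodic orbits if every orbit in it is periodic. It is eventually constant if there is an integer $N\ge0$ such that $\mathscr{O}_n(x_n^0,\theta)=\mathscr{O}_N(x_N^0,\theta)$ for all $n\ge N$. Throughout, the direction is $\theta=\pi/3$. *)

(* Defs.v *)
From HB Require Import structures.
From mathcomp Require Import all_boot all_order all_algebra.
From mathcomp Require Import all_classical all_reals all_analysis.
Set Implicit Arguments.
Unset Strict Implicit.
Unset Printing Implicit Defensive.
Import Order.TTheory GRing.Theory Num.Theory.
Import numFieldNormedType.Exports.
Local Open Scope classical_set_scope.
Local Open Scope ring_scope.

Definition segment {R : realType} (a b : R * R) : set (R * R) :=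
  [set a + t *: (b - a) | t in `[0, 1]].

Definition between {R : realType} (a b : R * R) : set (R * R) :=
  segment a b `\` [set a; b].

(* Clockwise rotation by pi/3. *)
Definition rotate_cw {R : realType} (w : R * R) : R * R :=
  (w.1 / 2 + Num.sqrt 3 / 2 * w.2, - (Num.sqrt 3 / 2) * w.1 + w.2 / 2).

(* Sides are oriented pairs of endpoints.  The polygons are traversed
   counterclockwise, so the outward normal of a side points to its right. *)
Definition koch_refine {R : realType} (e : (R * R) * (R * R)) :
    seq ((R * R) * (R * R)) :=
  let a := e.1 in let b := e.2 in
  let p := a + (1 / 3) *: (b - a) in
  let q := a + (2 / 3) *: (b - a) in
  let s := p + rotate_cw (q - p) in
  [:: (a, p); (p, s); (s, q); (q, b)].

Definition triangle_sides {R : realType} : seq ((R * R) * (R * R)) :=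
  let A := (0, 0) in let B := (1, 0) in let C := (1 / 2, Num.sqrt 3 / 2) in
  [:: (A, B); (B, C); (C, A)].

Definition KS_sides {R : realType} (n : nat) : seq ((R * R) * (R * R)) :=
  iter n (fun es => flatten (map koch_refine es)) triangle_sides.

Definition KS {R : realType} (n : nat) : set (R * R) :=
  [set x | exists2 e, e \in KS_sides n & segment e.1 e.2 x].

Definition KS_vertex {R : realType} (n : nat) : set (R * R) :=
  [set x | exists2 e, e \in KS_sides n & x = e.1].

(* The compact region bounded by the closed curve KS n: the curve together with
   the bounded components of its complement. *)
Definition Omega {R : realType} (n : nat) : set (R * R) :=
  [set x | KS n x \/
     (~ KS n x /\ bounded_set (connected_component (~` KS n) x))].

(* Directions, i.e. elements of S^1, are unit vectors. *)
Definition direction {R : realType} (theta : R) : R * R :=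
  (cos theta, sin theta).

Definition inward {R : realType} (n : nat) (x v : R * R) : Prop :=
  \forall t \near 0^'+, (Omega n)° (x + t *: v).

(* (KS n x S^1)/~, each class being represented by its inward direction. *)
Definition phase_space {R : realType} (n : nat) :
    set ((R * R) * (R * R)) :=
  [set p | [/\ KS n p.1, p.2.1 ^+ 2 + p.2.2 ^+ 2 = 1 & inward n p.1 p.2]].

Definition first_hit {R : realType} (n : nat) (x v y : R * R) : Prop :=
  exists t : R, [/\ 0 < t, y = x + t *: v, KS n y &
    forall s : R, 0 < s < t -> ~ KS n (x + s *: v)].

Definition dot {R : realType} (u v : R * R) : R := u.1 * v.1 + u.2 * v.2.

Definition reflect_in {R : realType} (e : (R * R) * (R * R)) (v : R * R) :
    R * R :=
  let d := e.2 - e.1 in (2 * dot v d / dot d d) *: d - v.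

(* Graph of the billiard map f_n.  It is single-valued away from the vertices;
   at a vertex, where f_n is not defined, the reflections in both adjacent sides
   are kept, so that the orbit records that it hits the vertex. *)
Definition billiard_map {R : realType} (n : nat)
    (p q : (R * R) * (R * R)) : Prop :=
  [/\ phase_space n p, first_hit n p.1 p.2 q.1 &
    exists e, [/\ e \in KS_sides n, segment e.1 e.2 q.1 &
                  q.2 = reflect_in e p.2]].

Fixpoint billiard_iter {R : realType} (n k : nat)
    (p q : (R * R) * (R * R)) : Prop :=
  if k is k'.+1 then
    exists2 m, billiard_iter n k' p m & billiard_map n m q
  else p = q.

Definition billiard_orbit {R : realType} (n : nat)
    (p : (R * R) * (R * R)) : set ((R * R) * (R * R)) :=
  [set q | exists k, billiard_iter n k p q].

Definition periodic_orbit {R : realType} (n : nat)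
    (p : (R * R) * (R * R)) : Prop :=
  (exists2 k, (0 < k)%N & billiard_iter n k p p) /\
  (forall q, billiard_orbit n p q -> ~ KS_vertex n q.1).

Definition compatible_basepoints {R : realType} (theta : R)
    (x : nat -> R * R) : Prop :=
  forall n, [/\ KS n (x n), inward n (x n) (direction theta),
    exists t : R, x n = x 0%N + t *: direction theta &
    forall y, between (x n) (x 0%N) y -> ~ KS n y].

Definition compatible_periodic_orbits {R : realType} (theta : R)
    (x : nat -> R * R) : Prop :=
  compatible_basepoints theta x /\
  forall n, periodic_orbit n (x n, direction theta).

Definition eventually_constant {R : realType} (theta : R)
    (x : nat -> R * R) : Prop :=
  exists N, forall n, (N <= n)%N ->
    billiard_orbit n (x n, direction theta) =
    billiard_orbit N (x N, direction theta).

Inductive ternary_char := char_l | char_c | char_r.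

Definition digit (a : ternary_char) : nat :=
  match a with char_l => 0 | char_c => 1 | char_r => 2 end.

Definition ternary_representation {R : realType} (d : nat -> ternary_char)
    (s : R) : Prop :=
  series (fun k : nat => (digit (d k))%:R / 3 ^+ k.+1 : R) @ \oo --> s.

(* Main.v *)
Require Import Defs.
From mathcomp Require Import all_boot all_order all_algebra.
From mathcomp Require Import all_classical all_reals all_analysis.
From mathcomp Require Import ring lra zify.
Import Order.TTheory GRing.Theory Num.Theory.
Import numFieldNormedType.Exports.
Local Open Scope classical_set_scope.
Local Open Scope ring_scope.

(** The direction pi/3 and all sides of all the polygons KS n are parallel to
    the edges of the triangular lattice, and the sides of KS n are edges of the
    lattice of mesh 3^-n.  A billiard trajectory in KS n with such directions
    therefore stays on lines parallel to lattice edges.  Such a line meets the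
    lattice edges that it crosses at points dividing them in the ratio u or
    1 - u, for a number u that depends only on the starting point, and a
    reflection in a lattice edge preserves this.  For 0 < u < 1 no vertex is
    ever hit, and an orbit has finitely many possible states: a side, a
    parameter in {u, 1 - u} and one of two inward directions (koch_state).  The
    billiard map sends states to states (koch_state_hit, koch_state_arrival)
    and can be run backwards (billiard_map_inj); a reversible motion in a finite
    set is periodic (koch_state_periodic).

    Let x_0 have ternary digits d_0, d_1, etc.  Following the ray from x_0 in
    the direction opposite to pi/3, each digit c moves the base point across the
    new triangle to one of its two new sides, while l and r leave it where it
    is.  In each case the parameter of x_n on its side of KS n has the ternary
    digits d_n, d_(n+1), etc. (shifted_param), and lies strictly between 0 and 1
    because l and r both occur infinitely often.  So every orbit is periodic.

    Once no c is left, the parameters u and 1 - u avoid the middle thirds, so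
    every bounce point of the orbit in KS n still lies on KS (n+1), with the
    same tangent direction.  As KS (n+1) does not enter the region enclosed by
    KS n (fillS), the chords of the orbit do not meet it either, and the two
    orbits coincide (billiard_orbit_refine).

    Two geometric facts support this.  Each side carries a thin rhombus with
    that side as long diagonal; rhombi of different sides of KS n do not overlap
    (rhombus_disjoint), which makes the curve self-avoiding.  And the region
    obtained by adding the successive triangles (filled) has its boundary on
    KS n (open_fill), so its points off KS n lie in bounded components of the
    complement (fill_sub_Omega). *)

(** * Coordinates attached to an oriented side *)

Section Charts.
Context {R : realType}.
Implicit Types (e f c : (R * R) * (R * R)) (v w z : R * R) (al be : R).

Lemma sqrt3_gt0 : 0 < Num.sqrt 3 :> R.
Proof. by rewrite sqrtr_gt0. Qed.

Lemma sqrt3_neq0 : Num.sqrt 3 != 0 :> R.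
Proof. by rewrite gt_eqF// sqrt3_gt0. Qed.

Lemma sqrt3_sqr : Num.sqrt 3 * Num.sqrt 3 = 3 :> R.
Proof. by rewrite -expr2 sqr_sqrtr. Qed.

Lemma scaler_pairE (k : R) z : k *: z = (k * z.1, k * z.2).
Proof. by case: z. Qed.

Lemma rotate_cwZ (k : R) w : rotate_cw (k *: w) = k *: rotate_cw w.
Proof. by rewrite /rotate_cw !scaler_pairE; congr pair => /=; ring. Qed.

Lemma rotate_cw2 w : rotate_cw (rotate_cw w) = rotate_cw w - w.
Proof. by rewrite /rotate_cw; congr pair => /=; field: sqrt3_sqr. Qed.

Lemma dot_rotate_cw w : dot (rotate_cw w) (rotate_cw w) = dot w w.
Proof. by rewrite /rotate_cw /dot /=; field: sqrt3_sqr. Qed.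

Lemma dotZ (k : R) w : dot (k *: w) (k *: w) = k ^+ 2 * dot w w.
Proof. by rewrite scaler_pairE /dot /=; ring. Qed.

Lemma dot_eq0 w : (dot w w == 0) = (w == 0).
Proof.
case: w => x y; rewrite /dot /= paddr_eq0 ?mulf_eq0 -?expr2 ?sqr_ge0//.
by rewrite !orbb -pair_eqE.
Qed.

Definition side_vec e : R * R := e.2 - e.1.

(** An oblique frame adapted to the side: its second axis is the first one turned
    clockwise by pi/3, so a positive second coordinate means outside.  The
    refinement of a side has rational coefficients in this frame, which turns
    all the plane geometry below into linear arithmetic. *)
Definition at_coords e al be : R * R :=
  e.1 + al *: side_vec e + be *: rotate_cw (side_vec e).

Definition aside e z : R :=
  2 / Num.sqrt 3 *
  ((z.1 - e.1.1) * (side_vec e).2 - (z.2 - e.1.2) * (side_vec e).1) /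
  dot (side_vec e) (side_vec e).

Definition along e z : R :=
  dot (z - e.1) (side_vec e) / dot (side_vec e) (side_vec e) - aside e z / 2.

Definition proper_side e := dot (side_vec e) (side_vec e) != 0.

Lemma coordsK {e} z :
  proper_side e -> at_coords e (along e z) (aside e z) = z.
Proof.
move: e z => [[a1 a2] [b1 b2]] [z1 z2].
rewrite /proper_side /at_coords /along /aside /side_vec /dot /rotate_cw.
rewrite !scaler_pairE /= => ne0.
by congr pair => /=; field: sqrt3_sqr; rewrite ?ne0 ?sqrt3_neq0.
Qed.

Lemma aside_at_coords {e} al be :
  proper_side e -> aside e (at_coords e al be) = be.
Proof.
move: e => [[a1 a2] [b1 b2]].
rewrite /proper_side /at_coords /along /aside /side_vec /dot /rotate_cw.
rewrite !scaler_pairE /= => ne0.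
by field: sqrt3_sqr; rewrite ?ne0 ?sqrt3_neq0.
Qed.

Lemma along_at_coords {e} al be :
  proper_side e -> along e (at_coords e al be) = al.
Proof.
move=> ne; rewrite /along aside_at_coords//; move: e ne => [[a1 a2] [b1 b2]].
rewrite /proper_side /at_coords /along /aside /side_vec /dot /rotate_cw.
rewrite !scaler_pairE /= => ne0.
by field: sqrt3_sqr; rewrite ?ne0 ?sqrt3_neq0.
Qed.

Definition trisect e (k : R) : R * R := e.1 + (k / 3) *: (e.2 - e.1).
Definition tip e : R * R :=
  trisect e 1 + rotate_cw (trisect e 2 - trisect e 1).

Definition left_part e := (e.1, trisect e 1).
Definition down_part e := (trisect e 1, tip e).
Definition up_part e := (tip e, trisect e 2).
Definition right_part e := (trisect e 2, e.2).

Lemma koch_refineE e :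
  koch_refine e = [:: left_part e; down_part e; up_part e; right_part e].
Proof. by []. Qed.

Lemma side_vec_left e : side_vec (left_part e) = 3^-1 *: side_vec e.
Proof.
by rewrite /side_vec /= /trisect !scaler_pairE; congr pair => /=; field.
Qed.
Lemma side_vec_right e : side_vec (right_part e) = 3^-1 *: side_vec e.
Proof.
by rewrite /side_vec /= /trisect !scaler_pairE; congr pair => /=; field.
Qed.
Lemma side_vec_down e :
  side_vec (down_part e) = 3^-1 *: rotate_cw (side_vec e).
Proof.
rewrite /side_vec /= /tip /trisect /rotate_cw !scaler_pairE.
by congr pair => /=; field.
Qed.
Lemma side_vec_up e :
  side_vec (up_part e) = 3^-1 *: (side_vec e - rotate_cw (side_vec e)).
Proof.
rewrite /side_vec /= /tip /trisect /rotate_cw !scaler_pairE.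
by congr pair => /=; field.
Qed.

Lemma proper_side_refine {e c} :
  proper_side e -> c \in koch_refine e -> proper_side c.
Proof.
rewrite /proper_side => ne.
have h3 : 3^-1 ^+ 2 != 0 :> R by rewrite expf_neq0// invr_neq0.
rewrite koch_refineE !inE => /or4P[] /eqP ->.
- by rewrite side_vec_left dotZ mulf_neq0.
- by rewrite side_vec_down dotZ dot_rotate_cw mulf_neq0.
- have -> : side_vec (up_part e) =
      (- 3^-1) *: rotate_cw (rotate_cw (side_vec e)).
    by rewrite side_vec_up rotate_cw2 scaleNr -scalerN opprB.
  by rewrite dotZ !dot_rotate_cw sqrrN mulf_neq0.
- by rewrite side_vec_right dotZ mulf_neq0.
Qed.

Lemma at_coords_left e al be :
  at_coords (left_part e) al be = at_coords e (al / 3) (be / 3).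
Proof.
rewrite /at_coords side_vec_left rotate_cwZ /=.
by rewrite /rotate_cw !scaler_pairE; congr pair => /=; field.
Qed.
Lemma at_coords_right e al be :
  at_coords (right_part e) al be = at_coords e ((al + 2) / 3) (be / 3).
Proof.
rewrite /at_coords side_vec_right rotate_cwZ /= /trisect -/(side_vec e).
by rewrite /rotate_cw !scaler_pairE; congr pair => /=; field.
Qed.
Lemma at_coords_down e al be :
  at_coords (down_part e) al be =
  at_coords e ((1 - be) / 3) ((al + be) / 3).
Proof.
rewrite /at_coords side_vec_down !rotate_cwZ rotate_cw2 /= /trisect.
rewrite -/(side_vec e) /rotate_cw !scaler_pairE.
by congr pair => /=; field.
Qed.
Lemma at_coords_up e al be :
  at_coords (up_part e) al be =
  at_coords e ((1 + al + be) / 3) ((1 - al) / 3).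
Proof.
rewrite /at_coords side_vec_up !rotate_cwZ /= /tip /trisect -/(side_vec e).
rewrite /rotate_cw !scaler_pairE.
by congr pair => /=; field: sqrt3_sqr.
Qed.

Lemma coords_eq {e} z al be : proper_side e -> z = at_coords e al be ->
  (along e z = al) * (aside e z = be).
Proof. by move=> ne ->; split; rewrite ?along_at_coords ?aside_at_coords. Qed.

Section Parts.
Context {e : (R * R) * (R * R)} (z : R * R) (ne : proper_side e).
Let a := along e z.
Let b := aside e z.

(** The passage from the frame of a side to the frames of its four parts: one
    homothety of ratio 3 followed by a lattice motion. *)
Lemma coords_left :
  (along (left_part e) z = 3 * a) * (aside (left_part e) z = 3 * b).
Proof.
apply: coords_eq; first by rewrite (proper_side_refine ne)// !inE eqxx.
rewrite at_coords_left -[LHS](coordsK _ ne).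
by congr at_coords; rewrite -/a -/b; field.
Qed.
Lemma coords_down : (along (down_part e) z = 3 * a + 3 * b - 1) *
  (aside (down_part e) z = 1 - 3 * a).
Proof.
apply: coords_eq; first by rewrite (proper_side_refine ne)// !inE eqxx orbT.
rewrite at_coords_down -[LHS](coordsK _ ne).
by congr at_coords; rewrite -/a -/b; field.
Qed.
Lemma coords_up : (along (up_part e) z = 1 - 3 * b) *
  (aside (up_part e) z = 3 * a + 3 * b - 2).
Proof.
apply: coords_eq; first by rewrite (proper_side_refine ne)// !inE eqxx !orbT.
rewrite at_coords_up -[LHS](coordsK _ ne).
by congr at_coords; rewrite -/a -/b; field.
Qed.
Lemma coords_right :
  (along (right_part e) z = 3 * a - 2) * (aside (right_part e) z = 3 * b).
Proof.
apply: coords_eq; first by rewrite (proper_side_refine ne)// !inE eqxx !orbT.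
rewrite at_coords_right -[LHS](coordsK _ ne).
by congr at_coords; rewrite -/a -/b; field.
Qed.
End Parts.

Lemma segment_coords {e} z : proper_side e ->
  segment e.1 e.2 z <-> aside e z = 0 /\ 0 <= along e z <= 1.
Proof.
move=> ne; split.
  move=> [t /=]; rewrite in_itv /= => t01 zE.
  have [-> ->] // : (along e z = t) * (aside e z = 0).
  by apply: coords_eq => //; rewrite -zE /at_coords scale0r addr0.
move=> [b0 a01]; exists (along e z); first by rewrite /= in_itv.
by rewrite -[RHS](coordsK _ ne) b0 /at_coords scale0r addr0.
Qed.

Lemma at_coords_ray {e} al be al' be' (s : R) :
  at_coords e al be + s *: (al' *: side_vec e + be' *: rotate_cw (side_vec e))
  = at_coords e (al + s * al') (be + s * be').
Proof.
by rewrite /at_coords /rotate_cw !scaler_pairE; congr pair => /=; ring.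
Qed.

Lemma continuous_aside e : continuous (aside e).
Proof.
have c1 : continuous (fun z : R * R => z.1) by move=> z; exact: cvg_fst.
have c2 : continuous (fun z : R * R => z.2) by move=> z; exact: cvg_snd.
move=> z; rewrite /aside.
apply: cvgM; last exact: cvg_cst.
apply: cvgM; first exact: cvg_cst.
apply: cvgB; (apply: cvgM; last exact: cvg_cst); apply: cvgB;
  by [exact: c1|exact: c2|exact: cvg_cst].
Qed.

Lemma continuous_along e : continuous (along e).
Proof.
have c1 : continuous (fun z : R * R => z.1) by move=> z; exact: cvg_fst.
have c2 : continuous (fun z : R * R => z.2) by move=> z; exact: cvg_snd.
move=> z; rewrite /along /dot.
apply: cvgB.
  apply: cvgM; last exact: cvg_cst.
  apply: cvgD; (apply: cvgM; last exact: cvg_cst).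
    by apply: cvgB; [exact: c1|exact: cvg_cst].
  by apply: cvgB; [exact: c2|exact: cvg_cst].
by apply: cvgM; [exact: continuous_aside|exact: cvg_cst].
Qed.

End Charts.

(** * Self-avoidance of the Koch polygons *)

Section Curve.
Context {R : realType}.
Implicit Types (e f c : (R * R) * (R * R)) (v w z : R * R) (n : nat).

Lemma KS_sidesS n c : reflect
  (exists2 e, e \in KS_sides n & c \in koch_refine e) (c \in KS_sides n.+1).
Proof. exact: flatten_mapP. Qed.

Definition base_side : (R * R) * (R * R) := ((0, 0), (1, 0)).
Definition apex : R * R := (1 / 2, Num.sqrt 3 / 2).

Lemma triangle_sidesE :
  triangle_sides = [:: base_side; ((1, 0), apex); (apex, (0, 0))].
Proof. by []. Qed.

Lemma KS_sides0 :
  KS_sides 0 = [:: base_side; ((1, 0), apex); (apex, (0, 0))].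
Proof. by []. Qed.

Lemma proper_side_triangle e : e \in triangle_sides -> proper_side e.
Proof.
rewrite triangle_sidesE !inE => /or3P[] /eqP ->;
  rewrite /proper_side /dot /side_vec /=.
- by rewrite subr0 subrr mulr0 addr0 mulr1 oner_neq0.
- have -> : (1 / 2 - 1) * (1 / 2 - 1) + (Num.sqrt 3 / 2 - 0) *
    (Num.sqrt 3 / 2 - 0) = 1 :> R by field: (@sqrt3_sqr R).
  exact: oner_neq0.
- have -> : (0 - 1 / 2) * (0 - 1 / 2) + (0 - Num.sqrt 3 / 2) *
    (0 - Num.sqrt 3 / 2) = 1 :> R by field: (@sqrt3_sqr R).
  exact: oner_neq0.
Qed.

Lemma proper_side_KS n e : e \in KS_sides n -> proper_side e.
Proof.
elim: n e => [|n IH] e; first exact: proper_side_triangle.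
by move=> /KS_sidesS[f /IH]; exact: proper_side_refine.
Qed.

Lemma coords_triangle z (x := along base_side z) (y := aside base_side z) :
  ((along ((1, 0), apex) z = 1 - x - y) * (aside ((1, 0), apex) z = x - 1)) *
  ((along (apex, (0, 0)) z = 1 + y) * (aside (apex, (0, 0)) z = - x - y)).
Proof.
have nd i e : e = nth e triangle_sides i -> (i < 3)%N -> proper_side e.
  by move=> -> i3; apply: proper_side_triangle; apply: mem_nth.
split; apply: coords_eq.
- exact: (nd 1%N).
- rewrite -[LHS](coordsK z (nd 0%N base_side erefl isT)) -/x -/y.
  rewrite /at_coords /side_vec /rotate_cw !scaler_pairE /=.
  by congr pair => /=; field: (@sqrt3_sqr R).
- exact: (nd 2%N).
- rewrite -[LHS](coordsK z (nd 0%N base_side erefl isT)) -/x -/y.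
  rewrite /at_coords /side_vec /rotate_cw !scaler_pairE /=.
  by congr pair => /=; field: (@sqrt3_sqr R).
Qed.

(** The rhombus with the side as long diagonal and angles pi/3 at its endpoints;
    the linear forms [along + 2 aside] and [along - aside] vanish on two adjacent
    edges.  It is thin enough for the rhombi of the four parts to be disjoint
    and thick enough to contain them, so it isolates everything that later
    grows on the side. *)
Definition open_rhombus e z :=
  (0 < along e z + 2 * aside e z < 1) && (0 < along e z - aside e z < 1).
Definition rhombus e z :=
  (0 <= along e z + 2 * aside e z <= 1) && (0 <= along e z - aside e z <= 1).
(** The outer half of the rhombus, which is the convex hull of the Koch curve
    grown on the side. *)
Definition koch_hull e z := rhombus e z && (0 <= aside e z).
Definition open_hull e z := open_rhombus e z && (0 < aside e z).
(** The equilateral triangle on the inner side of [e]. *)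
Definition left_triangle e z :=
  [&& aside e z <= 0, 0 <= along e z + aside e z & along e z <= 1].
Definition koch_bump e z :=
  [&& 0 <= aside e z, 1 / 3 <= along e z & along e z + aside e z <= 2 / 3].
(** The new triangle deprived of its two new sides, but with the open middle
    third that the refinement removes: the part of the plane that the next
    polygon leaves free. *)
Definition half_open_bump e z :=
  [&& 0 <= aside e z, 1 / 3 < along e z & along e z + aside e z < 2 / 3].

Lemma koch_refine_ind (P : (R * R) * (R * R) -> Prop) e :
  P (left_part e) -> P (down_part e) -> P (up_part e) -> P (right_part e) ->
  forall c, c \in koch_refine e -> P c.
Proof.
by move=> P1 P2 P3 P4 c; rewrite koch_refineE !inE => /or4P[] /eqP ->.
Qed.

Section Refine.
Context {e : (R * R) * (R * R)} (ne : proper_side e).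

Let coords z := (coords_left z ne, coords_down z ne, coords_up z ne,
  coords_right z ne).

Lemma rhombus_refine c z : c \in koch_refine e -> rhombus c z -> rhombus e z.
Proof.
move: c; apply: koch_refine_ind; rewrite /rhombus !coords; lra.
Qed.

Lemma open_rhombus_refine c z :
  c \in koch_refine e -> open_rhombus c z -> open_rhombus e z.
Proof.
move: c; apply: koch_refine_ind; rewrite /open_rhombus !coords; lra.
Qed.

Lemma open_hull_refine c z :
  c \in koch_refine e -> open_hull c z -> open_hull e z.
Proof.
move: c; apply: koch_refine_ind;
  rewrite /open_hull /open_rhombus !coords; lra.
Qed.

Lemma rhombus_siblings c c' z : c \in koch_refine e -> c' \in koch_refine e ->
  open_rhombus c z -> rhombus c' z -> c = c'.
Proof.
move: c; apply: koch_refine_ind; move: c'; apply: koch_refine_ind => //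
  o r; exfalso; move: o r; rewrite /open_rhombus /rhombus !coords; lra.
Qed.

(** The inner triangles of the two new sides are the new triangle itself; those
    of the outer parts are homothetic to the old one. *)
Lemma left_triangle_refine c z : c \in koch_refine e ->
  left_triangle c z -> left_triangle e z || koch_bump e z.
Proof.
move: c; apply: koch_refine_ind; rewrite /left_triangle /koch_bump !coords; lra.
Qed.

Lemma koch_bump_rhombus z : koch_bump e z -> rhombus e z.
Proof. rewrite /koch_bump /rhombus; lra. Qed.

Lemma half_open_bump_rhombus z : half_open_bump e z -> open_rhombus e z.
Proof. rewrite /half_open_bump /open_rhombus; lra. Qed.

Lemma koch_bump_open_hull c z :
  c \in koch_refine e -> open_hull c z -> koch_bump e z -> False.
Proof.
move: c; apply: koch_refine_ind;
  rewrite /open_hull /open_rhombus /koch_bump !coords; lra.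
Qed.

Lemma half_open_bump_segment c z :
  c \in koch_refine e -> segment c.1 c.2 z -> half_open_bump e z -> False.
Proof.
move=> ce; rewrite segment_coords ?(proper_side_refine ne)//.
move: c ce; apply: koch_refine_ind;
  rewrite /half_open_bump !coords => -[]; lra.
Qed.

Lemma segment_refine_hull c z :
  c \in koch_refine e -> segment c.1 c.2 z -> koch_hull e z.
Proof.
move=> ce; rewrite segment_coords ?(proper_side_refine ne)//.
move: c ce; apply: koch_refine_ind;
  rewrite /koch_hull /rhombus !coords => -[]; lra.
Qed.

Lemma segment_rhombus z : segment e.1 e.2 z -> rhombus e z.
Proof. rewrite segment_coords// /rhombus => -[]; lra. Qed.

Lemma koch_bump_or_sides z : koch_bump e z ->
  half_open_bump e z \/ exists2 c, c \in koch_refine e & segment c.1 c.2 z.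
Proof.
move=> bz; have [a1|a1] := eqVneq (along e z) (1 / 3).
  right; exists (down_part e); first by rewrite !inE eqxx !orbT.
  rewrite segment_coords ?(proper_side_refine ne) ?inE ?eqxx ?orbT//.
  by rewrite !coords; move: bz; rewrite /koch_bump; lra.
have [a2|a2] := eqVneq (along e z + aside e z) (2 / 3).
  right; exists (up_part e); first by rewrite !inE eqxx !orbT.
  rewrite segment_coords ?(proper_side_refine ne) ?inE ?eqxx ?orbT//.
  by rewrite !coords; move: bz; rewrite /koch_bump; lra.
by left; move: bz a1 a2; rewrite /koch_bump /half_open_bump; lra.
Qed.

Lemma segment_refine z : segment e.1 e.2 z ->
  half_open_bump e z \/ exists2 c, c \in koch_refine e & segment c.1 c.2 z.
Proof.
rewrite segment_coords// => -[b0 a01].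
have [a1|a1] := leP (along e z) (1 / 3).
  right; exists (left_part e); first by rewrite !inE eqxx.
  rewrite segment_coords ?(proper_side_refine ne) ?inE ?eqxx ?orbT//.
  by rewrite !coords; lra.
have [a2|a2] := leP (2 / 3) (along e z).
  right; exists (right_part e); first by rewrite !inE eqxx !orbT.
  rewrite segment_coords ?(proper_side_refine ne) ?inE ?eqxx ?orbT//.
  by rewrite !coords; lra.
by left; rewrite /half_open_bump b0; lra.
Qed.

End Refine.

(** The rhombi of the parts are nested in the rhombus of the side, so an overlap
    would descend from an overlap between siblings or between sides of the
    initial triangle. *)
Lemma rhombus_disjoint n e f z : e \in KS_sides n -> f \in KS_sides n ->
  open_rhombus e z -> rhombus f z -> e = f.
Proof.
elim: n e f => [|n IH] c c'.
  have [[h1 h2] [h3 h4]] := coords_triangle z.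
  rewrite /KS_sides /= triangle_sidesE !inE.
  by move=> /or3P[] /eqP -> /or3P[] /eqP -> //;
    move=> o r; exfalso; move: o r;
    rewrite /open_rhombus /rhombus ?h1 ?h2 ?h3 ?h4; lra.
move=> /KS_sidesS[e en ce] /KS_sidesS[f fn cf] oz rz.
have nde := proper_side_KS n e en; have ndf := proper_side_KS n f fn.
have ef : e = f.
  exact: IH en fn (open_rhombus_refine nde _ _ ce oz)
    (rhombus_refine ndf _ _ cf rz).
by rewrite -ef in cf; apply: rhombus_siblings nde _ _ _ ce cf oz rz.
Qed.

End Curve.

(** * The region enclosed by the polygon *)

Section Filled.
Context {R : realType}.
Implicit Types (e f c : (R * R) * (R * R)) (v w z : R * R) (n : nat).

Lemma closed_seq_union {T : topologicalType} {I : eqType} (s : seq I)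
    (A : I -> set T) : (forall i, i \in s -> closed (A i)) ->
  closed [set z | exists2 i, i \in s & A i z].
Proof.
elim: s => [_|i s IH clA].
  have -> : [set z | exists2 i : I, i \in [::] & A i z] = set0; last exact: closed0.
  by rewrite -subset0 => z [].
have -> : [set z | exists2 j, j \in i :: s & A j z] =
    A i `|` [set z | exists2 j, j \in s & A j z].
  rewrite eqEsubset; split => z.
    by move=> [j]; rewrite inE => /orP[/eqP -> Az|js Az]; [left|right; exists j].
  move=> [Az|[j js Az]]; first by exists i => //; rewrite mem_head.
  by exists j => //; rewrite inE js orbT.
apply: closedU; first by apply: clA; rewrite mem_head.
by apply: IH => j js; apply: clA; rewrite inE js orbT.
Qed.

Lemma continuous_coords e (p q r : R) :
  continuous (fun z => p * along e z + q * aside e z + r).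
Proof.
move=> z; apply: cvgD; last exact: cvg_cst.
by apply: cvgD; apply: cvgM; first [exact: cvg_cst
  |exact: continuous_along|exact: continuous_aside].
Qed.

Lemma closed_coords e (p q r : R) :
  closed [set z | 0 <= p * along e z + q * aside e z + r].
Proof.
apply: (closed_comp (f := fun z => p * along e z + q * aside e z + r)
  (D := [set x | 0 <= x])) => [z _|]; first exact: continuous_coords.
exact: closed_ge.
Qed.

Lemma open_coords e (p q r : R) :
  open [set z | 0 < p * along e z + q * aside e z + r].
Proof.
apply: (open_comp (f := fun z => p * along e z + q * aside e z + r)
  (D := [set x | 0 < x])) => [z _|]; first exact: continuous_coords.
exact: open_gt.
Qed.

Lemma closed_left_triangle e : closed [set z | left_triangle e z].
Proof.
have -> : [set z | left_triangle e z] =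
    [set z | 0 <= 0 * along e z + (-1) * aside e z + 0] `&`
    [set z | 0 <= 1 * along e z + 1 * aside e z + 0] `&`
    [set z | 0 <= (-1) * along e z + 0 * aside e z + 1].
  rewrite eqEsubset; split => z /=; rewrite /left_triangle.
    by move=> h; do ?split; lra.
  by move=> [[]]; lra.
by do ?apply: closedI; exact: closed_coords.
Qed.

Lemma closed_koch_bump e : closed [set z | koch_bump e z].
Proof.
have -> : [set z | koch_bump e z] =
    [set z | 0 <= 0 * along e z + 1 * aside e z + 0] `&`
    [set z | 0 <= 1 * along e z + 0 * aside e z + (- (1 / 3))] `&`
    [set z | 0 <= (-1) * along e z + (-1) * aside e z + 2 / 3].
  rewrite eqEsubset; split => z /=; rewrite /koch_bump.
    by move=> h; do ?split; lra.
  by move=> [[]]; lra.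
by do ?apply: closedI; exact: closed_coords.
Qed.

Lemma closed_segment e : proper_side e -> closed (segment e.1 e.2).
Proof.
move=> ne; have -> : segment e.1 e.2 =
    [set z | 0 <= 0 * along e z + 1 * aside e z + 0] `&`
    [set z | 0 <= 0 * along e z + (-1) * aside e z + 0] `&`
    [set z | 0 <= 1 * along e z + 0 * aside e z + 0] `&`
    [set z | 0 <= (-1) * along e z + 0 * aside e z + 1].
  rewrite eqEsubset; split => z /=.
    by rewrite segment_coords// => -[b0 a01]; do ?split; lra.
  move=> [[[h1 h2] h3] h4]; rewrite segment_coords//.
  by split; [apply/eqP; rewrite eq_le|]; lra.
by do ?apply: closedI; exact: closed_coords.
Qed.

(** An explicit substitute for the compact region bounded by KS n: the initial
    triangle with all the triangles added so far. *)
Fixpoint filled n : set (R * R) :=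
  if n is m.+1 then
    filled m `|` [set z | exists2 e, e \in KS_sides m & koch_bump e z]
  else [set z | left_triangle base_side z].

Lemma closed_KS n : closed (KS n : set (R * R)).
Proof.
by apply: closed_seq_union => e /proper_side_KS; exact: closed_segment.
Qed.

Lemma closed_filled n : closed (filled n).
Proof.
elim: n => [|n IH]; first exact: closed_left_triangle.
by apply: closedU => //; apply: closed_seq_union => e _; exact: closed_koch_bump.
Qed.

(** This gives every side of KS n a whole neighbourhood on its inner side inside
    the filled region. *)
Lemma left_triangle_filled n e z :
  e \in KS_sides n -> left_triangle e z -> filled n z.
Proof.
elim: n e => [|n IH] e.
  have h := coords_triangle z.
  rewrite /KS_sides /= triangle_sidesE !inE.
  by move=> /or3P[] /eqP ->; rewrite /left_triangle ?h; lra.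
move=> /KS_sidesS[f fn ef] /(left_triangle_refine (proper_side_KS _ _ fn) _ _ ef).
by move=> /orP[/(IH _ fn)|fz]; [left|right; exists f].
Qed.

(** On its outer side, no side of KS n borders the filled region: a new triangle
    lies in the rhombus of its own side, which is disjoint from the others, and
    within that rhombus the four new hulls avoid it. *)
Lemma filled_not_open_hull n f z :
  f \in KS_sides n -> filled n z -> open_hull f z -> False.
Proof.
elim: n f => [|n IH] c.
  have h := coords_triangle z.
  rewrite /KS_sides /= triangle_sidesE !inE.
  by move=> /or3P[] /eqP ->; rewrite /left_triangle /open_hull ?h; lra.
move=> /KS_sidesS[f fn cf]; have pf := proper_side_KS _ _ fn.
move=> [/(IH f fn) h /(open_hull_refine pf _ _ cf)//|[e en ez] hz].
have /andP[oz _] := open_hull_refine pf _ _ cf hz.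
have ef := rhombus_disjoint _ _ _ _ fn en oz (koch_bump_rhombus _ ez).
by rewrite -ef in ez; exact: koch_bump_open_hull pf _ _ cf hz ez.
Qed.

(** Every other part of the next polygon lies in the rhombus of another side. *)
Lemma half_open_bump_notin_KS n e z :
  e \in KS_sides n -> half_open_bump e z -> ~ KS n.+1 z.
Proof.
move=> en ez [c /KS_sidesS[f fn cf] cz]; have pf := proper_side_KS _ _ fn.
have pc := proper_side_refine pf cf.
have fz := rhombus_refine pf _ _ cf (segment_rhombus pc _ cz).
have ef := rhombus_disjoint _ _ _ _ en fn (half_open_bump_rhombus _ ez) fz.
by rewrite -ef in cf pf; exact: half_open_bump_segment pf _ _ cf cz ez.
Qed.

Definition fill n := filled n `\` KS n.

Lemma interior_witness {T : topologicalType} (A U : set T) (x : T) :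
  open U -> U x -> U `<=` A -> A° x.
Proof.
by move=> oU Ux UA; apply: (filterS UA); exact: open_nbhs_nbhs.
Qed.

(** The boundary of the filled region is on the curve.  The only points of KS n
    that leave the curve at the next step are in open middle thirds, and there
    the inner triangle and the new triangle together form a neighbourhood. *)
Lemma open_fill n : open (fill n).
Proof.
have oKS m : open (~` (KS m : set (R * R))) by exact/closed_openC/closed_KS.
elim: n => [|n IH].
  have -> : fill 0 =
      [set z | 0 < 0 * along base_side z + (-1) * aside base_side z + 0] `&`
      [set z | 0 < 1 * along base_side z + 1 * aside base_side z + 0] `&`
      [set z | 0 < (-1) * along base_side z + 0 * aside base_side z + 1].
    rewrite eqEsubset; split => z; have h := coords_triangle z.
      move=> [Tz nKz]; suff: ~~ [|| aside base_side z == 0,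
          along base_side z + aside base_side z == 0 |
          along base_side z == 1].
        by move: Tz; rewrite /= /left_triangle; split; [split|]; lra.
      apply/negP => bz; apply: nKz; move: bz Tz => /or3P[] bz /= Tz.
      - exists base_side; first by rewrite KS_sides0 !inE eqxx.
        rewrite segment_coords ?proper_side_triangle//; last first.
          by rewrite triangle_sidesE !inE eqxx.
        by move: bz Tz; rewrite /left_triangle; split; lra.
      - exists (apex, (0, 0)); first by rewrite KS_sides0 !inE eqxx !orbT.
        rewrite segment_coords ?proper_side_triangle//; last first.
          by rewrite triangle_sidesE !inE eqxx !orbT.
        by rewrite !h; move: bz Tz; rewrite /left_triangle; split; lra.
      - exists ((1, 0), apex); first by rewrite KS_sides0 !inE eqxx !orbT.
        rewrite segment_coords ?proper_side_triangle//; last first.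
          by rewrite triangle_sidesE !inE eqxx !orbT.
        by rewrite !h; move: bz Tz; rewrite /left_triangle; split; lra.
    move=> [[h1 h2] h3]; split.
      by move: h1 h2 h3; rewrite /= /left_triangle; lra.
    move=> [e]; rewrite /KS_sides /= triangle_sidesE.
    move=> et; rewrite segment_coords ?proper_side_triangle//.
    move: et h1 h2 h3; rewrite !inE /=.
    by move=> /or3P[] /eqP ->; rewrite ?h; move=> ? ? ? [] ? ?; lra.
  by do ?apply: openI; exact: open_coords.
rewrite openE => z [Tz nKz].
have key : (exists2 e, e \in KS_sides n & half_open_bump e z) ->
    (fill n.+1)° z.
  move=> [e en ez].
  apply: (interior_witness _ (([set z | 0 < 1 * along e z + 0 * aside e z + (- (1 / 3))] `&`
      [set z | 0 < (-1) * along e z + (-1) * aside e z + 2 / 3] `&`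
      [set z | 0 < 0 * along e z + 1 * aside e z + 1 / 3]) `&`
      ~` KS n.+1)).
  - by do ?apply: openI; rewrite //; exact: open_coords.
  - by split=> //; move: ez; rewrite /half_open_bump /=; do ?split; lra.
  - move=> y [[[/= h1 h2] h3] nKy]; split=> //.
  have [b0|b0] := leP 0 (aside e y).
    by right; exists e => //; rewrite /koch_bump; lra.
  left; apply: left_triangle_filled en _; rewrite /left_triangle; lra.
have [[e en ez]|nKz'] := pselect (KS n z).
  have pe := proper_side_KS _ _ en.
  have [ebz|[c ce cz]] := segment_refine pe _ ez; first by apply: key; exists e.
  by case: nKz; exists c => //; apply/KS_sidesS; exists e.
case: Tz => [Tz|[e en ez]].
  apply: (interior_witness _ (fill n `&` ~` KS n.+1)) => //; first exact: openI.
  by move=> y [[Ty _] nKy]; split=> //; left.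
have pe := proper_side_KS _ _ en.
have [ebz|[c ce cz]] := koch_bump_or_sides pe _ ez; first by apply: key; exists e.
by case: nKz; exists c => //; apply/KS_sidesS; exists e.
Qed.

Lemma open_ray (U : set (R * R)) z v : open U -> U z ->
  exists2 eps : R, 0 < eps & forall s, 0 <= s < eps -> U (z + s *: v).
Proof.
move=> oU Uz.
have : \forall s \near (0 : R), U (z + s *: v).
  have cf : (fun s : R => z + s *: v) @ (0 : R) --> z + (0 : R) *: v.
    apply: cvgD; first exact: cvg_cst.
    by apply: cvgZ; [exact: cvg_id|exact: cvg_cst].
  apply: cf; apply: open_nbhs_nbhs; split=> //.
  by rewrite scale0r addr0.
move=> /nbhs_ballP[eps /= eps0 h]; exists eps => // s /andP[s0 se].
by apply: h; rewrite /ball /= sub0r normrN ger0_norm.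
Qed.

(** The next polygon does not enter the region already enclosed: it lies in the
    closed hulls of the sides, and an open set meeting a closed hull would meet
    the open hull, which is outside the filled region. *)
Lemma fillS n z : fill n z -> fill n.+1 z.
Proof.
move=> Fz; split; first by left; case: Fz.
move=> [c /KS_sidesS[f fn cf] cz]; have pf := proper_side_KS _ _ fn.
have hz := segment_refine_hull pf _ _ cf cz.
(* The point with coordinates (1/2, 1/6) is interior to the hull; a small step
   towards it enters the open hull. *)
have [eps eps0 h] := open_ray _ z
  ((1 / 2 - along f z) *: side_vec f +
   (1 / 6 - aside f z) *: rotate_cw (side_vec f)) (open_fill n) Fz.
pose s := Num.min (eps / 2) (1 / 2).
have s0 : 0 < s by rewrite lt_min; lra.
have s1 : s <= 1 / 2 by rewrite ge_min lexx orbT.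
have se : s < eps by rewrite gt_min; apply/orP; left; lra.
have [] := h s; first by rewrite ltW.
rewrite -{1}(coordsK z pf) at_coords_ray => Tz _.
apply: (filled_not_open_hull _ _ _ fn Tz).
rewrite /open_hull /open_rhombus along_at_coords// aside_at_coords//.
by move: hz; rewrite /koch_hull /rhombus; nra.
Qed.

(** Off the curve the filled region is both open and closed, so a connected set
    that avoids the curve cannot leave it. *)
Lemma connected_fill n (C : set (R * R)) z : connected C ->
  C `<=` ~` KS n -> C z -> fill n z -> C `<=` fill n.
Proof.
move=> cC CK Cz Fz; suff <- : C `&` fill n = C by move=> y [].
apply: cC; first by exists z.
  by exists (fill n) => //; exact: open_fill.
exists (filled n); first exact: closed_filled.
by rewrite eqEsubset; split => y [Cy]; [case|]; split => //; split => //; exact: CK.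
Qed.

Lemma bounded_filled n : exists M : R, forall z, filled n z -> `|z| <= M.
Proof.
have bnd e : proper_side e -> exists M : R, forall z,
    (-1 <= along e z <= 1) -> (-1 <= aside e z <= 1) -> `|z| <= M.
  move=> pe; exists (`|e.1| + `|side_vec e| + `|rotate_cw (side_vec e)|) => z a1 b1.
  rewrite -[z](coordsK z pe) /at_coords (le_trans (ler_normD _ _))// lerD//.
    rewrite (le_trans (ler_normD _ _))// lerD// normrZ.
    by rewrite ler_piMl// ler_norml.
  by rewrite normrZ ler_piMl// ler_norml.
elim: n => [|n [M HM]].
  have [|M HM] := bnd base_side.
    by rewrite proper_side_triangle// triangle_sidesE !inE eqxx.
  by exists M => z /=; rewrite /left_triangle => h; apply: HM; lra.
suff [M' HM'] : exists M' : R, forall z,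
    (exists2 e, e \in KS_sides n & koch_bump e z) -> `|z| <= M'.
  exists (Num.max M M') => z; rewrite le_max.
  by move=> [/HM ->//|/HM' ->]; rewrite orbT.
have: forall e, e \in KS_sides n -> proper_side e by move=> e; exact: proper_side_KS.
elim: (KS_sides n) => [_|e s IH ps]; first by exists 0 => z [].
have [|M1 HM1] := IH; first by move=> f fs; apply: ps; rewrite inE fs orbT.
have [|M2 HM2] := bnd e; first by apply: ps; rewrite mem_head.
exists (Num.max M2 M1) => z [f]; rewrite inE le_max => /orP[/eqP -> ez|fs fz].
  by rewrite HM2//; move: ez; rewrite /koch_bump; lra.
by rewrite HM1 ?orbT//; exists f.
Qed.

Lemma fill_sub_Omega n : fill n `<=` (Omega n)°.
Proof.
rewrite -open_subsetE; last exact: open_fill.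
move=> z Fz; right; have [_ nKz] := Fz; split => //.
have [M HM] := bounded_filled n.
have CF : connected_component (~` KS n) z `<=` fill n.
  apply: connected_fill (Fz).
  - exact: component_connected.
  - exact: connected_component_sub.
  - exact: connected_component_refl.
rewrite /bounded_set; exists M; split; first exact: num_real.
by move=> M' MM' y /CF[/HM yM _]; apply: le_trans yM (ltW MM').
Qed.

End Filled.

(** * Lattice edges and the transverse coordinate of a line *)

Section Lattice.
Context {R : realType}.
Implicit Types (e f c : (R * R) * (R * R)) (v w z : R * R) (n k : nat) (u t : R).

(** The six unit directions of the triangular lattice, listed periodically. *)
Definition unit_dir k : R * R := iter k rotate_cw (1, 0).
Definition eisenstein (i j : int) : R * R :=
  (i%:~R + j%:~R / 2, - (Num.sqrt 3 / 2) * j%:~R).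

Lemma unit_dirS k : unit_dir k.+1 = rotate_cw (unit_dir k).
Proof. by []. Qed.

Lemma unit_dirSS k : unit_dir k.+2 = rotate_cw (unit_dir k) - unit_dir k.
Proof. by rewrite !unit_dirS rotate_cw2. Qed.

Lemma unit_dir3 k : unit_dir (k + 3)%N = - unit_dir k.
Proof.
by rewrite addn3 unit_dirSS -unit_dirS unit_dirSS addrAC subrr sub0r.
Qed.

Lemma unit_dir5 k : unit_dir (k + 5)%N = unit_dir k - rotate_cw (unit_dir k).
Proof. have -> : (k + 5 = k + 2 + 3)%N by lia.
by rewrite unit_dir3 addn2 unit_dirSS opprB. Qed.

Lemma unit_dir_mod6 k : unit_dir (k %% 6)%N = unit_dir k.
Proof.
rewrite [in RHS](divn_eq k 6); elim: (k %/ 6)%N => [//|q ->].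
have -> : (q.+1 * 6 + k %% 6 = q * 6 + k %% 6 + 3 + 3)%N by lia.
by rewrite !unit_dir3 opprK.
Qed.

Lemma dot_unit_dir k : dot (unit_dir k) (unit_dir k) = 1.
Proof.
elim: k => [|k IH]; last by rewrite unit_dirS dot_rotate_cw.
by rewrite /dot /= mulr0 addr0 mulr1.
Qed.

Lemma unit_dir_eisenstein k : exists i j, unit_dir k = eisenstein i j.
Proof.
elim: k => [|k [i [j ij]]].
  by exists 1, 0; rewrite /eisenstein mul0r mulr0 addr0.
exists (- j), (i + j); rewrite unit_dirS ij /eisenstein /rotate_cw /=.
by rewrite !(rmorphD, rmorphN) /=; congr pair; field: (@sqrt3_sqr R).
Qed.

Lemma eisensteinD i j i' j' :
  eisenstein i j + eisenstein i' j' = eisenstein (i + i') (j + j').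
Proof. by rewrite /eisenstein !rmorphD; congr pair => /=; ring. Qed.

Lemma eisenstein3 i j : 3 *: eisenstein i j = eisenstein (3 * i) (3 * j).
Proof.
by rewrite /eisenstein scaler_pairE !rmorphM; congr pair => /=; ring.
Qed.

Definition on_lattice n e :=
  (exists i j, e.1 = (3 ^+ n)^-1 *: eisenstein i j) /\
  exists k, side_vec e = (3 ^+ n)^-1 *: unit_dir k.

Lemma KS_lattice n e : e \in KS_sides n -> on_lattice n e.
Proof.
elim: n e => [|n IH] c.
  rewrite KS_sides0 !inE /on_lattice expr0 invr1 => /or3P[] /eqP -> /=; split.
  - by exists 0, 0; rewrite scale1r /eisenstein mul0r mulr0 addr0.
  - by exists 0; rewrite scale1r /side_vec /= subr0.
  - by exists 1, 0; rewrite scale1r /eisenstein mul0r mulr0 addr0.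
  - exists 4%N; rewrite scale1r (unit_dir3 1) /side_vec /unit_dir /rotate_cw /=.
    by congr pair => /=; field.
  - exists 1, (-1); rewrite scale1r /eisenstein /apex.
    by rewrite rmorphN /=; congr pair => /=; field.
  - exists 2%N; rewrite scale1r unit_dirSS /side_vec /unit_dir /rotate_cw /=.
    by congr pair => /=; field.
move=> /KS_sidesS[e /IH[[i [j eij]] [k ek]] ce].
have s3 w : (3 ^+ n)^-1 *: w = (3 ^+ n.+1)^-1 *: (3 *: w).
  rewrite scalerA exprS invfM mulrAC -mulrA mulrA mulVf ?mul1r//.
have s3' w : 3^-1 *: ((3 ^+ n)^-1 *: w) = (3 ^+ n.+1)^-1 *: w.
  by rewrite scalerA exprS invfM.
have lat w : (exists i j, w = eisenstein i j) -> exists i j, e.1 +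
    (3 ^+ n.+1)^-1 *: w = (3 ^+ n.+1)^-1 *: eisenstein i j.
  move=> [i' [j' ->]]; exists (3 * i + i'), (3 * j + j').
  by rewrite eij s3 -scalerDr eisenstein3 eisensteinD.
have tri (k' : R) : trisect e k' = e.1 + (3 ^+ n.+1)^-1 *: (k' *: unit_dir k).
  rewrite /trisect -/(side_vec e) ek -s3' !scalerA.
  by congr (_ + _ *: _); ring.
move: c ce; apply: koch_refine_ind; split => /=.
- by exists (3 * i), (3 * j); rewrite eij s3 eisenstein3.
- by exists k; rewrite side_vec_left ek s3'.
- rewrite tri scale1r; apply: lat; exact: unit_dir_eisenstein.
- by exists k.+1; rewrite side_vec_down ek rotate_cwZ s3'.
- rewrite /tip !tri scale1r opprD addrACA subrr add0r -scalerBr.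
  rewrite scaler_nat mulr2n addrK rotate_cwZ -addrA -scalerDr; apply: lat.
  have [a [b ab]] := unit_dir_eisenstein k.
  have [a' [b' ab']] := unit_dir_eisenstein k.+1.
  by exists (a + a'), (b + b'); rewrite -unit_dirS ab ab' eisensteinD.
- by exists (k + 5)%N; rewrite side_vec_up ek rotate_cwZ -scalerBr s3' unit_dir5.
- rewrite tri; apply: lat; have [a [b ->]] := unit_dir_eisenstein k.
  by exists (a + a), (b + b); rewrite scaler_nat mulr2n eisensteinD.
- by exists k; rewrite side_vec_right ek s3'.
Qed.

(** A velocity given by its coordinates in the frame of [e], scaled by 3^n so
    that the lattice directions become unit vectors. *)
Definition heading n e (p q : R) : R * R :=
  (3 ^+ n) *: (p *: side_vec e + q *: rotate_cw (side_vec e)).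

Lemma expr3_neq0 n : 3 ^+ n != 0 :> R.
Proof. by rewrite expf_neq0. Qed.
Lemma expr3_gt0 n : 0 < 3 ^+ n :> R.
Proof. by rewrite exprn_gt0. Qed.

Lemma heading_unit_dir n e k p q : side_vec e = (3 ^+ n)^-1 *: unit_dir k ->
  heading n e p q = p *: unit_dir k + q *: unit_dir k.+1.
Proof.
move=> ek; rewrite /heading ek rotate_cwZ !scalerDr !scalerA.
by rewrite ![3 ^+ n * _]mulrC !mulfK ?expr3_neq0.
Qed.

(** The six lattice directions, seen from any side of KS n. *)
Lemma unit_dir_heading n e k : e \in KS_sides n ->
  exists2 pq : R * R, pq \in [:: (1, 0); (0, 1); (-1, 1); (-1, 0); (0, -1); (1, -1)] &
    unit_dir k = heading n e pq.1 pq.2.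
Proof.
move=> /KS_lattice[_ [k0 ek]].
have [r r6 ->] : exists2 r, (r < 6)%N & unit_dir k = unit_dir (k0 + r)%N.
  exists ((k + 5 * k0) %% 6)%N; first by rewrite ltn_mod.
  rewrite -[RHS]unit_dir_mod6 modnDmr -[LHS]unit_dir_mod6; congr unit_dir; lia.
have hE p q := heading_unit_dir n e k0 p q ek.
have := unit_dirSS k0; rewrite -unit_dirS => d2.
have d3 := unit_dir3 k0.
have d4 : unit_dir (k0 + 4)%N = - unit_dir k0.+1.
  have -> : (k0 + 4 = k0 + 1 + 3)%N by lia.
  by rewrite unit_dir3 addn1.
have d5 := unit_dir5 k0; rewrite -unit_dirS in d5.
case: r r6 => [|[|[|[|[|[|//]]]]]] _; rewrite ?addn0 ?addn1 ?addn2 ?d2 ?d3 ?d4 ?d5.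
- by exists (1, 0); rewrite ?inE ?eqxx// hE scale1r scale0r addr0.
- by exists (0, 1); rewrite ?inE ?eqxx ?orbT// hE scale1r scale0r add0r.
- by exists (-1, 1); rewrite ?inE ?eqxx ?orbT// hE scale1r scaleN1r addrC.
- by exists (-1, 0); rewrite ?inE ?eqxx ?orbT// hE scaleN1r scale0r addr0.
- by exists (0, -1); rewrite ?inE ?eqxx ?orbT// hE scaleN1r scale0r add0r.
- by exists (1, -1); rewrite ?inE ?eqxx ?orbT// hE scale1r scaleN1r.
Qed.

(** The coordinate that is constant along the lines of direction [v], in units of
    the distance between neighbouring lattice lines of mesh 3^-n: it takes
    integer values at the lattice points. *)
Definition transverse n v z : R :=
  3 ^+ n * (2 / Num.sqrt 3) * (v.2 * z.1 - v.1 * z.2).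

Lemma transverse_ray n v z (s : R) :
  transverse n v (z + s *: v) = transverse n v z.
Proof. by rewrite /transverse scaler_pairE /=; ring. Qed.

Lemma transverse_int n e k : e \in KS_sides n ->
  exists m : int, transverse n (unit_dir k) e.1 = m%:~R.
Proof.
move=> /KS_lattice[[i [j ->]] _]; have [a [b ->]] := unit_dir_eisenstein k.
exists (a * j - b * i); rewrite /transverse /eisenstein scaler_pairE /=.
rewrite !(rmorphB, rmorphM) /=.
by field; rewrite expr3_neq0 sqrt3_neq0.
Qed.

(** On a side not parallel to [v], the position of a point is determined modulo 1
    and up to sign by the transverse coordinate; on a side parallel to [v] the
    latter is an integer. *)
Lemma transverse_heading n e p q z : e \in KS_sides n ->
  transverse n (heading n e p q) z =
  transverse n (heading n e p q) e.1 + (p * aside e z - q * along e z).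
Proof.
move=> en; have pe := proper_side_KS _ _ en.
have [_ [k ek]] := KS_lattice _ _ en.
have dw : dot (side_vec e) (side_vec e) = (3 ^+ n)^-1 * (3 ^+ n)^-1.
  by rewrite ek dotZ dot_unit_dir mulr1 expr2.
rewrite -{1}[z](coordsK z pe); move: (along e z) (aside e z) => a b.
rewrite /heading /at_coords; move: (side_vec e) dw => [w1 w2].
rewrite /dot /= => dw; rewrite /transverse /rotate_cw !scaler_pairE /=.
have {}dw : 3 ^+ n * (3 ^+ n) * w2 * w2 = 1 - 3 ^+ n * (3 ^+ n) * w1 * w1.
  apply/eqP; rewrite eq_sym subr_eq -!mulrA -!mulrDr [w2 * _ + _]addrC dw.
  by rewrite !mulrA mulfK ?divff// expr3_neq0.
move: (3 ^+ n : R) dw => x dw.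
by field: dw (@sqrt3_sqr R); rewrite sqrt3_neq0.
Qed.

End Lattice.

(** * The billiard map on the states with parameter u *)

Section Dynamics.
Context {R : realType}.
Implicit Types (e f c : (R * R) * (R * R)) (v w z : R * R) (n k : nat).
Implicit Types (t u : R) (p q : (R * R) * (R * R)).

(** The states that an orbit with parameter [u] can take: in the frame of the side,
    the directions (1, -1) and (0, -1) point inwards at angles pi/3 and 2pi/3. *)
Definition koch_state n u p := exists e t,
  [/\ e \in KS_sides n, t = u \/ t = 1 - u, p.1 = at_coords e t 0 &
      p.2 = heading n e 1 (-1) \/ p.2 = heading n e 0 (-1)].

Lemma koch_state_unit_dir n u p :
  koch_state n u p -> exists k, p.2 = unit_dir k.
Proof.
move=> [e [t [en _ _]]]; have [_ [k ek]] := KS_lattice _ _ en.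
rewrite !(heading_unit_dir _ _ _ _ _ ek) scale1r scale0r add0r scaleN1r.
move=> [->|->]; first by exists (k + 5)%N; rewrite unit_dir5.
by exists (k.+1 + 3)%N; rewrite unit_dir3.
Qed.

Lemma at_coords_heading n e al be (a b s : R) :
  at_coords e al be + s *: heading n e a b =
  at_coords e (al + s * 3 ^+ n * a) (be + s * 3 ^+ n * b).
Proof.
rewrite /heading /at_coords; move: (side_vec e) => w.
by rewrite /rotate_cw !scaler_pairE; congr pair => /=; ring.
Qed.

Lemma reflect_heading n e a b : proper_side e ->
  reflect_in e (heading n e a b) = heading n e (a + b) (- b).
Proof.
rewrite /proper_side /reflect_in /heading -/(side_vec e).
move: (side_vec e) (3 ^+ n : R) => [w1 w2] x.
rewrite /dot /rotate_cw !scaler_pairE /= => ne0.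
by congr pair => /=; field: (@sqrt3_sqr R).
Qed.

Lemma reflect_inK e v : proper_side e -> reflect_in e (reflect_in e v) = v.
Proof.
rewrite /proper_side /reflect_in -/(side_vec e).
case: v => v1 v2; move: (side_vec e) => [w1 w2].
by rewrite /dot !scaler_pairE /= => ne0; congr pair => /=; field.
Qed.

Lemma segment_at_coords e t : 0 <= t <= 1 -> proper_side e ->
  segment e.1 e.2 (at_coords e t 0).
Proof.
by move=> t01 pe; rewrite segment_coords// along_at_coords// aside_at_coords.
Qed.

(** An interior point of a side lies inside the rhombus of that side. *)
Lemma side_unique {n e f t} : e \in KS_sides n -> f \in KS_sides n ->
  0 < t < 1 -> segment f.1 f.2 (at_coords e t 0) -> e = f.
Proof.
move=> en fn t01 fz; have pe := proper_side_KS _ _ en.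
apply: rhombus_disjoint en fn _ (segment_rhombus (proper_side_KS _ _ fn) _ fz).
by rewrite /open_rhombus along_at_coords// aside_at_coords//; lra.
Qed.

Lemma state_param u t : 0 < u < 1 -> t = u \/ t = 1 - u -> 0 < t < 1.
Proof. by move=> u01 [] ->; lra. Qed.

Lemma koch_state_not_vertex n u p :
  0 < u < 1 -> koch_state n u p -> ~ KS_vertex n p.1.
Proof.
move=> u01 [e [t [en /(state_param _ _ u01) t01 -> _]]] [f fn zf].
have pe := proper_side_KS _ _ en; have pf := proper_side_KS _ _ fn.
have f1 : at_coords f 0 0 = f.1 by rewrite /at_coords !scale0r !addr0.
have ef : e = f.
  apply: (side_unique en fn t01); rewrite zf -[X in segment _ _ X]f1.
  by apply: segment_at_coords => //; lra.
have : along e (at_coords e t 0) = along e (at_coords f 0 0) by rewrite zf f1.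
rewrite -ef !along_at_coords//; lra.
Qed.

Lemma fill_below_side n e z : e \in KS_sides n ->
  open_rhombus e z -> aside e z < 0 -> fill n z.
Proof.
move=> en oz b0; split.
  apply: left_triangle_filled en _.
  by move: oz b0; rewrite /open_rhombus /left_triangle; lra.
move=> [f fn fz]; have pf := proper_side_KS _ _ fn.
have ef := rhombus_disjoint _ _ _ _ en fn oz (segment_rhombus pf _ fz).
by move: fz b0; rewrite segment_coords// ef; lra.
Qed.

Lemma koch_state_inside n u p : 0 < u < 1 -> koch_state n u p ->
  exists2 eps : R, 0 < eps & forall s, 0 < s < eps -> fill n (p.1 + s *: p.2).
Proof.
move=> u01 [e [t [en /(state_param _ _ u01) t01 -> ph]]].
have pe := proper_side_KS _ _ en.
have x0 := expr3_gt0 (R := R) n.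
have m0 : 0 < Num.min t (1 - t) by rewrite lt_min; lra.
exists (Num.min t (1 - t) / 4 / 3 ^+ n).
  by rewrite divr_gt0// divr_gt0.
move=> s; rewrite ltr_pdivlMr// => /andP[s0 s1].
have {s0} : 0 < s * 3 ^+ n by rewrite mulr_gt0.
have mt : Num.min t (1 - t) <= t by rewrite ge_min lexx.
have mt' : Num.min t (1 - t) <= 1 - t by rewrite ge_min lexx orbT.
move: (Num.min _ _) mt mt' s1 {m0} => m mt mt' s1 s0.
by apply: (fill_below_side n e) => //; case: ph => ->;
  rewrite at_coords_heading; move: (s * 3 ^+ n) s0 s1 => y s0 s1;
  rewrite /open_rhombus ?along_at_coords ?aside_at_coords//; lra.
Qed.

Lemma koch_state_phase n u p : 0 < u < 1 -> koch_state n u p -> phase_space n p.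
Proof.
move=> u01 sp; split.
- have [e [t [en /(state_param _ _ u01) t01 -> _]]] := sp.
  exists e => //; apply: segment_at_coords; last exact: proper_side_KS en.
  by lra.
- have [k ->] := koch_state_unit_dir n u p sp.
  by rewrite !expr2; exact: dot_unit_dir.
- have [eps eps0 h] := koch_state_inside n u p u01 sp.
  apply: filterS2 (nbhs_right_gt 0) (nbhs_right_lt eps0) => s s0 se.
  by apply: fill_sub_Omega; apply: h; rewrite s0.
Qed.

(** The chord starts inside the filled region and is connected. *)
Lemma chord_inside n u p t : 0 < u < 1 -> koch_state n u p ->
  (forall s, 0 < s < t -> ~ KS n (p.1 + s *: p.2)) ->
  forall s, 0 < s < t -> fill n (p.1 + s *: p.2).
Proof.
move=> u01 sp nK s st; have [eps eps0 h] := koch_state_inside n u p u01 sp.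
pose g (s : R) := p.1 + s *: p.2.
have cg : continuous g.
  move=> x; apply: cvgD; first exact: cvg_cst.
  by apply: cvgZ; [exact: cvg_id|exact: cvg_cst].
have cC : connected (g @` `]0, t[).
  apply: connected_continuous_connected; last exact: continuous_subspaceT.
  by apply/connected_intervalP; exact: interval_is_interval.
pose s0 := Num.min (eps / 2) s.
have s00 : 0 < s0 by rewrite lt_min; lra.
have s0s : s0 <= s by rewrite ge_min lexx orbT.
have s0e : s0 < eps by rewrite gt_min; apply/orP; left; lra.
apply: (connected_fill n _ (g s0) cC).
- by move=> y [x xt <-]; apply: nK; move: xt; rewrite /= in_itv.
- by exists s0 => //=; rewrite in_itv /=; lra.
- by apply: h; lra.
- by exists s => //=; rewrite in_itv.
Qed.

(** A ray that never met the curve would stay in the filled region, which is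
    bounded; the set of hitting times is closed and bounded away from 0, so its
    infimum is the first one. *)
Lemma koch_state_hit n u p : 0 < u < 1 -> koch_state n u p ->
  exists y, first_hit n p.1 p.2 y.
Proof.
move=> u01 sp; pose A := [set t : R | 0 < t /\ KS n (p.1 + t *: p.2)].
have [eps eps0 h] := koch_state_inside n u p u01 sp.
have lbA : lbound A eps.
  move=> t [t0 Kt]; rewrite leNgt; apply/negP => te.
  by have [] := h t; [rewrite t0|].
have A0 : A !=set0.
  apply/set0P/negP => /eqP A0.
  have F t : 0 < t -> fill n (p.1 + t *: p.2).
    move=> t0; apply: (chord_inside n u p (t + 1)) => //; last by lra.
    move=> s /andP[s0 _] Ks; have : A s by []. 
    by rewrite A0.
  have [M HM] := bounded_filled (R := R) n.
  have v0 : 0 < `|p.2|.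
    rewrite normr_gt0; have [k ->] := koch_state_unit_dir n u p sp.
    by rewrite -dot_eq0 dot_unit_dir oner_eq0.
  have M0 : 0 <= M.
    by apply: le_trans (HM _ (F 1 ltr01).1); rewrite normr_ge0.
  pose t := (M + `|p.1| + 1) / `|p.2|.
  have t0 : 0 < t by rewrite divr_gt0// ltr_wpDl// addr_ge0.
  have := HM _ (F t t0).1; apply/negP; rewrite -ltNge.
  have : `|t *: p.2| = M + `|p.1| + 1.
    by rewrite normrZ gtr0_norm// /t divfK// gt_eqF.
  have := ler_normB (p.1 + t *: p.2) p.1.
  rewrite [p.1 + _]addrC addrK => h1 h2; lra.
have hinf : has_inf A by split=> //; exists eps.
have einf : eps <= inf A by exact: lb_le_inf.
have i0 : 0 < inf A by exact: lt_le_trans einf.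
exists (p.1 + inf A *: p.2), (inf A); split=> //.
- apply: contrapT => nK.
  have [d d0 hd] := open_ray (~` KS n) (p.1 + inf A *: p.2) p.2
    (closed_openC (closed_KS n)) nK.
  have [t [t0 Kt] td] := inf_adherent d0 hinf.
  have it : inf A <= t by apply: ge_inf => //; exists eps.
  apply: (hd (t - inf A)); first by lra.
  by rewrite -addrA -scalerDl [inf A + _]addrC subrK.
- move=> s /andP[s0 si] Ks; move: si; rewrite ltNge => /negP; apply.
  by apply: ge_inf; [exists eps|].
Qed.

Lemma integer_lt1 (m : int) (x y : R) : x = y + m%:~R -> -1 < x - y < 1 -> x = y.
Proof.
move=> -> ; rewrite addrAC subrr add0r => /andP[m1 m2].
have m1' : -1 < m by rewrite -(ltr_int R) rmorphN.
have m2' : m < 1 by rewrite -(ltr_int R).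
have -> : m = 0 by lia.
by rewrite addr0.
Qed.

(** The transverse coordinate is the same at both ends of the chord.  At the start
    it is the parameter modulo 1, hence not an integer; this excludes sides
    parallel to the chord and forces the parameter [t] or [1 - t] at the end.
    The value [t] would belong to a chord reaching the side from outside. *)
Lemma koch_state_arrival n u p q : 0 < u < 1 -> koch_state n u p ->
  billiard_map n p q -> koch_state n u q.
Proof.
move=> u01 sp [_ [s [s0 yE Ky nK]] [f [fn fy q2]]].
have inside := chord_inside n u p s u01 sp nK.
have [k pk] := koch_state_unit_dir n u p sp.
have [e [t [en tu ze ph]]] := sp; have t01 := state_param _ _ u01 tu.
have pe := proper_side_KS _ _ en; have pf := proper_side_KS _ _ fn.
have [m mE] := transverse_int n e k en; have [m' mE'] := transverse_int n f k fn.
have te : transverse n p.2 p.1 = m%:~R + t.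
  by case: ph => ph; rewrite ph transverse_heading// -ph pk mE
    ze along_at_coords// aside_at_coords// mulr0 sub0r mulN1r opprK.
have [[a b] ab vf] := unit_dir_heading n f k fn.
have [f0 f01] := (segment_coords _ pf).1 fy.
have tf : m%:~R + t = m'%:~R - b * along f q.1.
  rewrite -te -(transverse_ray n p.2 p.1 s) -yE pk {1}vf transverse_heading//.
  by rewrite -vf mE' f0 mulr0 sub0r.
have qE : q.1 = at_coords f (along f q.1) 0 by rewrite -{1}[q.1](coordsK _ pf) f0.
have q2E : q.2 = heading n f (a + b) (- b) by rewrite q2 pk vf reflect_heading.
(* Just before arriving from the outer side, the chord would run in the open
   hull of f, which is disjoint from the filled region. *)
have from_left : 0 < along f q.1 < 1 -> b = -1 -> a = 0 \/ a = 1 -> False.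
  move=> y01 b1 a01; set tau := along f q.1 in y01 qE.
  have x0 := expr3_gt0 (R := R) n.
  have m0 : 0 < Num.min tau (1 - tau) by rewrite lt_min; lra.
  have mt : Num.min tau (1 - tau) <= tau by rewrite ge_min lexx.
  have mt' : Num.min tau (1 - tau) <= 1 - tau by rewrite ge_min lexx orbT.
  move: (Num.min _ _) m0 mt mt' => r m0 mt mt'.
  have r0 : 0 < r / 8 / 3 ^+ n by rewrite !divr_gt0.
  pose d := Num.min (s / 2) (r / 8 / 3 ^+ n).
  have d0 : 0 < d by rewrite lt_min r0; lra.
  have ds : d <= s / 2 by rewrite ge_min lexx.
  have {r0} dr : d * 3 ^+ n <= r / 8.
    by rewrite -ler_pdivlMr// ge_min lexx orbT.
  have {x0} d0' : 0 < d * 3 ^+ n by rewrite mulr_gt0.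
  have [|Tz _] := inside (s - d); first by lra.
  apply: (filled_not_open_hull _ _ _ fn Tz).
  have -> : p.1 + (s - d) *: p.2 = q.1 + (- d) *: p.2.
    by rewrite yE -addrA -scalerDl.
  rewrite qE pk vf at_coords_heading b1 mulNr.
  move: (d * _) dr d0' => y dr d0'.
  by rewrite /open_hull /open_rhombus along_at_coords// aside_at_coords//=;
    case: a01 => ->; lra.
have t_int (j : int) : t <> j%:~R.
  move=> tj; have : t = 0; last by lra.
  by apply: (integer_lt1 j); rewrite ?add0r ?tj// -tj; lra.
have b1_param : b = 1 -> along f q.1 = 1 - t.
  move=> b1; apply: (integer_lt1 (m' - m - 1)); last by lra.
  by rewrite !rmorphB /=; move: tf; rewrite b1; lra.
have bN1_param : b = -1 -> along f q.1 = t.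
  move=> b1; apply: (integer_lt1 (m - m')); last by lra.
  by rewrite !rmorphB /=; move: tf; rewrite b1; lra.
have b0 : b = 0 -> False.
  move=> b0; apply: (t_int (m' - m)); move: tf.
  by rewrite b0 rmorphB /=; lra.
have arrives : b = 1 -> a = 0 \/ a = -1 -> koch_state n u q.
  move=> b1 ha; exists f, (1 - t); split => //.
  - by case: tu => ->; [right|left; lra].
  - by rewrite {1}qE b1_param.
  - by rewrite q2E b1; case: ha => ->; rewrite ?add0r ?addNr; [left|right].
move: ab; rewrite !inE -!pair_eqE /=.
move=> /or4P[/andP[_ /eqP/b0//]|/andP[/eqP a0 /eqP b1]|/andP[/eqP a0 /eqP b1]|].
- by apply: arrives => //; left.
- by apply: arrives => //; right.
move=> /or3P[/andP[_ /eqP/b0//]|/andP[/eqP a0 /eqP b1]|/andP[/eqP a0 /eqP b1]].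
- by exfalso; apply: from_left => //; [rewrite (bN1_param b1); lra|left].
- by exfalso; apply: from_left => //; [rewrite (bN1_param b1); lra|right].
Qed.
End Dynamics.

(** * Periodicity *)

Section Orbits.
Context {R : realType}.
Implicit Types (e f c : (R * R) * (R * R)) (v w x y z : R * R) (n k : nat).
Implicit Types (t u : R) (p q : (R * R) * (R * R)).

Lemma first_hit_unique n x v y y' :
  first_hit n x v y -> first_hit n x v y' -> y = y'.
Proof.
move=> [t [t0 -> Kt nKt]] [t' [t'0 -> Kt' nKt']].
case: (ltgtP t t') => [tt'|t't|->//].
  by case: (nKt' t); rewrite ?t0.
by case: (nKt t'); rewrite ?t'0.
Qed.

Lemma koch_state_side_unique {n u q f f'} : 0 < u < 1 -> koch_state n u q ->
  f \in KS_sides n -> f' \in KS_sides n ->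
  segment f.1 f.2 q.1 -> segment f'.1 f'.2 q.1 -> f = f'.
Proof.
move=> u01 [e [t [en /(state_param _ _ u01) t01 -> _]]] fn fn' fq fq'.
by rewrite -(side_unique en fn t01 fq) -(side_unique en fn' t01 fq').
Qed.

Lemma billiard_map_unique n u p q q' : 0 < u < 1 -> koch_state n u p ->
  billiard_map n p q -> billiard_map n p q' -> q = q'.
Proof.
move=> u01 sp pq pq'; have sq := koch_state_arrival n u p q u01 sp pq.
move: pq pq' => [_ h [f [fn fq q2]]] [_ h' [f' [fn' fq' q2']]].
have q1 := first_hit_unique _ _ _ _ _ h h'; rewrite -q1 in fq'.
have ff' := koch_state_side_unique u01 sq fn fn' fq fq'.
by rewrite [q]surjective_pairing [q']surjective_pairing q1 q2 q2' ff'.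
Qed.

Lemma billiard_map_exists n u p : 0 < u < 1 -> koch_state n u p ->
  exists q, billiard_map n p q.
Proof.
move=> u01 sp; have [y hy] := koch_state_hit n u p u01 sp.
have [t [_ _ [f fn fy] _]] := hy.
exists (y, reflect_in f p.2); split=> //; last by exists f.
exact: koch_state_phase sp.
Qed.

(** Time reversal: the side containing the bounce point is unique, reflecting in
    it recovers the incoming direction, and the starting point is the first
    point of the curve met backwards. *)
Lemma billiard_map_inj n u p p' q : 0 < u < 1 ->
  koch_state n u p -> koch_state n u p' ->
  billiard_map n p q -> billiard_map n p' q -> p = p'.
Proof.
move=> u01 sp sp' pq pq'; have sq := koch_state_arrival n u p q u01 sp pq.
have [[Kp _ _] _ _] := pq; have [[Kp' _ _] _ _] := pq'.
move: pq pq' => [_ [t [t0 q1 _ nK]] [f [fn fq q2]]].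
move=> [_ [t' [t'0 q1' _ nK']] [f' [fn' fq' q2']]].
have ff' := koch_state_side_unique u01 sq fn fn' fq fq'.
have pf := proper_side_KS _ _ fn.
have v : p.2 = p'.2.
  by rewrite -(reflect_inK f p.2 pf) -q2 q2' ff' reflect_inK// -ff'.
have back : p.1 + t *: p.2 = p'.1 + t' *: p.2 by rewrite -q1 q1' v.
have shift (a b : R) (r r' : R * R) : r + a *: p.2 = r' + b *: p.2 ->
    r = r' + (b - a) *: p.2.
  by move=> h; rewrite scalerBl addrA -h addrK.
case: (ltgtP t t') => [tt'|t't|tt'].
- case: (nK' (t' - t)); first by lra.
  by rewrite -v -(shift t t' _ _ back).
- case: (nK (t - t')); first by lra.
  by rewrite -(shift t' t _ _ (esym back)).
- move: back; rewrite tt' => /addIr p1.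
  by rewrite [p]surjective_pairing [p']surjective_pairing p1 v.
Qed.

Definition all_koch_states n u : seq ((R * R) * (R * R)) :=
  flatten [seq [:: (at_coords e u 0, heading n e 1 (-1));
                   (at_coords e u 0, heading n e 0 (-1));
                   (at_coords e (1 - u) 0, heading n e 1 (-1));
                   (at_coords e (1 - u) 0, heading n e 0 (-1))]
          | e <- KS_sides n].

Lemma koch_state_finite n u p : koch_state n u p -> p \in all_koch_states n u.
Proof.
case: p => [z v] [e [t [en tu /= -> vE]]].
apply/flatten_mapP; exists e => //.
by case: tu => ->; case: vE => ->; rewrite !inE eqxx ?orbT.
Qed.

Lemma koch_state_iter n u p k q : 0 < u < 1 -> koch_state n u p ->
  billiard_iter n k p q -> koch_state n u q.
Proof.
move=> u01 sp; elim: k q => [q <-//|k IH q [m /IH sm mq]].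
exact: koch_state_arrival u01 sm mq.
Qed.

(** Among finitely many states two iterates coincide, and injectivity brings the
    coincidence back to the initial state. *)
Lemma koch_state_periodic n u p :
  0 < u < 1 -> koch_state n u p -> periodic_orbit n p.
Proof.
move=> u01 sp; split; last first.
  move=> q [k /(koch_state_iter _ _ _ _ _ u01 sp)].
  exact: koch_state_not_vertex.
have step p' : exists q',
    koch_state n u p' -> koch_state n u q' /\ billiard_map n p' q'.
  have [sp'|nsp'] := pselect (koch_state n u p'); last by exists p'.
  have [q p'q] := billiard_map_exists n u p' u01 sp'.
  by exists q; split=> //; exact: koch_state_arrival u01 sp' p'q.
have [F HF] := boolp.choice step.
have sF k : koch_state n u (iter k F p) by elim: k => [//|k /HF[]].
have iF k : billiard_iter n k p (iter k F p).
  by elim: k => [//|k IH]; exists (iter k F p) => //; have [] := HF _ (sF k).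
have Finj i j : iter i.+1 F p = iter j.+1 F p -> iter i F p = iter j F p.
  move=> ij; have [_ mi] := HF _ (sF i); have [_ mj] := HF _ (sF j).
  apply: billiard_map_inj u01 (sF i) (sF j) mi _.
  by rewrite -!iterS ij.
pose s := mkseq (fun k => iter k F p) (size (all_koch_states n u)).+1.
have : ~~ uniq s.
  apply/negP => us; have := uniq_leq_size us.
  rewrite size_mkseq => /(_ (all_koch_states n u)); rewrite ltnn => H.
  suff: false by []; apply: H => q /mapP[k _ ->]; exact: koch_state_finite.
move=> /(uniqPn p)[i [j [ij]]]; rewrite size_mkseq => js.
rewrite !nth_mkseq//; last exact: ltn_trans ij js.
move=> eij; exists (j - i)%N; first by rewrite subn_gt0.
suff back : iter (j - i) F p = p by rewrite -{2}back; exact: iF.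
elim: i j ij {js} eij => [|i IH] [//|j] ij eij; first by rewrite subn0 -eij.
by rewrite subSS; apply: IH => //; exact: Finj.
Qed.

End Orbits.

(** * Passing to the next polygon *)

Section Refinement.
Context {R : realType}.
Implicit Types (e f c : (R * R) * (R * R)) (v w x y z : R * R) (n k : nat).
Implicit Types (t u : R) (p q : (R * R) * (R * R)).

(** If [u] is in the first or last third with rescaled parameter [u'], then both
    [u] and [1 - u] survive the removal of the middle third, and on the outer
    part that contains them their parameters are [u'] and [1 - u'] in some
    order. *)
Lemma param_refine u u' e t :
  u' = 3 * u \/ u' = 3 * u - 2 -> t = u \/ t = 1 - u ->
  exists c t', [/\ c \in koch_refine e, t' = u' \/ t' = 1 - u',
    at_coords e t 0 = at_coords c t' 0 & side_vec c = 3^-1 *: side_vec e].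
Proof.
have left t' : at_coords (left_part e) (3 * t') 0 = at_coords e t' 0.
  by rewrite at_coords_left mul0r mulrAC divff ?mul1r.
have right t' : at_coords (right_part e) (3 * t' - 2) 0 = at_coords e t' 0.
  by rewrite at_coords_right mul0r subrK mulrAC divff ?mul1r.
have [hl hr] : left_part e \in koch_refine e /\ right_part e \in koch_refine e.
  by rewrite !inE !eqxx !orbT.
move=> [] -> [] ->.
- by exists (left_part e), (3 * u); split; rewrite ?left ?side_vec_left//; left.
- exists (right_part e), (3 * (1 - u) - 2); split;
    rewrite ?right ?side_vec_right//; right; ring.
- by exists (right_part e), (3 * u - 2); split; rewrite ?right ?side_vec_right//;
    left.
- exists (left_part e), (3 * (1 - u)); split;
    rewrite ?left ?side_vec_left//; right; ring.
Qed.

Lemma koch_state_refine n u u' p : u' = 3 * u \/ u' = 3 * u - 2 ->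
  koch_state n u p -> koch_state n.+1 u' p.
Proof.
move=> uu' [e [t [en tu p1 p2]]].
have [c [t' [ce tu' zE cE]]] := param_refine u u' e t uu' tu.
exists c, t'; split=> //; [by apply/KS_sidesS; exists e|by rewrite p1|].
have hE a b : heading n.+1 c a b = heading n e a b.
  rewrite /heading cE rotate_cwZ !scalerA.
  rewrite ![_ * 3^-1]mulrC -!scalerA -scalerDr scalerA exprSr.
  by rewrite mulfK.
by rewrite !hE.
Qed.

Lemma reflect_in_scaled c e (k : R) v : k != 0 -> proper_side e ->
  side_vec c = k *: side_vec e -> reflect_in c v = reflect_in e v.
Proof.
rewrite /proper_side /reflect_in -/(side_vec e) -/(side_vec c) => k0.
move: (side_vec e) => [w1 w2] ne0 ->; move: ne0; case: v => v1 v2.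
rewrite /dot !scaler_pairE /= => ne0.
have ne1 : k * w1 * (k * w1) + k * w2 * (k * w2) != 0.
  have -> : k * w1 * (k * w1) + k * w2 * (k * w2) = k * k * (w1 * w1 + w2 * w2).
    by ring.
  by rewrite !mulf_neq0.
by congr pair => /=; field; rewrite ne0 ne1.
Qed.

(** The chord remains free by [fillS], and the bounce point stays on a side with
    the same tangent direction, so the reflection is unchanged. *)
Lemma billiard_map_refine n u u' p q : 0 < u < 1 -> 0 < u' < 1 ->
  u' = 3 * u \/ u' = 3 * u - 2 -> koch_state n u p ->
  billiard_map n p q -> billiard_map n.+1 p q.
Proof.
move=> u01 u'01 uu' sp pq; have sq := koch_state_arrival n u p q u01 sp pq.
have [_ [t [t0 q1 _ nK]] [f [fn fq q2]]] := pq.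
have sq' := koch_state_refine n u u' q uu' sq.
have [Kq _ _] := koch_state_phase n.+1 u' q u'01 sq'.
split.
- by apply: (koch_state_phase n.+1 u' p u'01); exact: koch_state_refine sp.
- exists t; split=> // s st; have [_ nKs] : fill n.+1 (p.1 + s *: p.2).
    by apply: fillS; exact: chord_inside u01 sp nK s st.
  exact: nKs.
- have [e [r [en ru qe _]]] := sq.
  have ef : e = f.
    apply: (koch_state_side_unique u01 sq en fn _ fq); rewrite qe.
    apply: segment_at_coords; last exact: proper_side_KS en.
    by have := state_param _ _ u01 ru; lra.
  have [c [r' [ce ru' zE cE]]] := param_refine u u' e r uu' ru.
  have cn : c \in KS_sides n.+1 by apply/KS_sidesS; exists e.
  exists c; split=> //.
    rewrite qe zE; apply: segment_at_coords; last exact: proper_side_KS cn.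
    by have := state_param _ _ u'01 ru'; lra.
  rewrite q2 -ef; symmetry; apply: (reflect_in_scaled _ _ 3^-1) cE => //.
  exact: proper_side_KS en.
Qed.

(** One inclusion is [billiard_map_refine]; the other follows since the map of KS n
    is defined on all states and that of the next polygon is single-valued. *)
Lemma billiard_orbit_refine n u u' p : 0 < u < 1 -> 0 < u' < 1 ->
  u' = 3 * u \/ u' = 3 * u - 2 -> koch_state n u p ->
  billiard_orbit n.+1 p = billiard_orbit n p.
Proof.
move=> u01 u'01 uu' sp.
suff iterE k q : billiard_iter n.+1 k p q <-> billiard_iter n k p q.
  by rewrite eqEsubset; split => q [k /iterE]; exists k.
elim: k q => [//|k IH] q; split=> [[m /IH pm mq]|[m pm mq]]; exists m => //.
- have sm := koch_state_iter n u p k m u01 sp pm.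
  have [q' mq'] := billiard_map_exists n u m u01 sm.
  suff -> : q = q' by [].
  apply: (billiard_map_unique n.+1 u' m) => //.
    exact: koch_state_refine sm.
  exact: billiard_map_refine u01 u'01 uu' sm mq'.
- exact/IH.
- have sm := koch_state_iter n u p k m u01 sp pm.
  exact: billiard_map_refine u01 u'01 uu' sm mq.
Qed.

End Refinement.

(** * Compatible base points *)

Section Basepoints.
Context {R : realType} (s : R) (d : nat -> ternary_char).

(** The number whose ternary digits are those of [s] from the n-th on. *)
Fixpoint shifted_param n : R :=
  if n is m.+1 then 3 * shifted_param m - (digit (d m))%:R else s.

(** The side of KS n that carries the n-th base point.  The boolean tells whether
    the direction pi/3 makes the angle pi/3 or 2pi/3 with that side: going
    backwards across a new triangle leads to its descending side in the first
    case and to its ascending side in the second, and exchanges the two. *)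
Fixpoint base_chain n : ((R * R) * (R * R)) * bool :=
  if n is m.+1 then
    let: (e, b) := base_chain m in
    match d m with
    | char_l => (left_part e, b)
    | char_c => (if b then down_part e else up_part e, ~~ b)
    | char_r => (right_part e, b)
    end
  else (base_side, true).

Definition basepoint n : R * R :=
  at_coords (base_chain n).1 (shifted_param n) 0.

Definition chain_heading n (eb : ((R * R) * (R * R)) * bool) : R * R :=
  heading n eb.1 (if eb.2 then 1 else 0) (-1).

Lemma base_chain_side n : (base_chain n).1 \in KS_sides n.
Proof.
elim: n => [|n IH]; first by rewrite KS_sides0 inE eqxx.
apply/KS_sidesS; exists (base_chain n).1 => //=.
by case: (base_chain n) => e b; case: (d n); case: b; rewrite !inE eqxx ?orbT.
Qed.

(** The cosine of pi/3 is the positive root of 4x^3 - 3x + 1, by the formula for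
    the triple angle. *)
Lemma cos_pi3 : cos (pi / 3) = 1 / 2 :> R.
Proof.
have pi0 := pi_gt0 R.
have c0 : 0 < cos (pi / 3 : R) by apply: cos_gt0_pihalf; lra.
have : cos (pi / 3 + (pi / 3 + pi / 3)) = -1 :> R.
  by rewrite -[RHS]cospi; congr cos; field.
rewrite !cosD sinD; have := cos2Dsin2 (pi / 3 : R).
move: (cos _) (sin _) c0 => c x c0 h1 h2.
have : (c + 1) * ((2 * c - 1) * (2 * c - 1)) = 0.
  have x2 : x * x = 1 - c * c by rewrite -!expr2 -h1; ring.
  have h3 : 4 * c ^+ 3 - 3 * c = -1 by rewrite -h2; ring: x2.
  have -> : (c + 1) * ((2 * c - 1) * (2 * c - 1)) = 4 * c ^+ 3 - 3 * c + 1.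
    by ring.
  by rewrite h3; ring.
move/eqP; rewrite !mulf_eq0 => /orP[/eqP|/orP[]/eqP]; lra.
Qed.

Lemma direction_pi3 : direction (pi / 3) = (1 / 2, Num.sqrt 3 / 2) :> R * R.
Proof.
rewrite /direction cos_pi3; congr pair.
have pi0 := pi_gt0 R.
have s0 : 0 < sin (pi / 3 : R) by apply: sin_gt0_pi; lra.
have := cos2Dsin2 (pi / 3 : R); rewrite cos_pi3 => h.
apply/eqP; rewrite -(eqrXn2 (n := 2))// ?ltW// ?divr_ge0 ?sqrtr_ge0//.
by rewrite exprMn sqr_sqrtr//; apply/eqP; lra.
Qed.

Lemma base_chain_heading n :
  direction (pi / 3) = chain_heading n (base_chain n).
Proof.
elim: n => [|n ->].
  rewrite direction_pi3 /chain_heading /heading /= /side_vec /rotate_cw.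
  by rewrite !scaler_pairE /=; congr pair => /=; field.
rewrite /chain_heading /=; case: (base_chain n) => e b /=.
rewrite /heading exprSr.
case: (d n) => /=.
- rewrite side_vec_left; move: (side_vec e) => w.
  by rewrite /rotate_cw !scaler_pairE; congr pair => /=; field.
- case: b => /=; rewrite ?side_vec_down ?side_vec_up; move: (side_vec e) => w.
    by rewrite /rotate_cw !scaler_pairE; congr pair => /=; field: (@sqrt3_sqr R).
  by rewrite /rotate_cw !scaler_pairE; congr pair => /=; field: (@sqrt3_sqr R).
- rewrite side_vec_right; move: (side_vec e) => w.
  by rewrite /rotate_cw !scaler_pairE; congr pair => /=; field.
Qed.

Lemma basepoint_state n :
  koch_state n (shifted_param n) (basepoint n, direction (pi / 3)).
Proof.
exists (base_chain n).1, (shifted_param n); split=> //.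
- exact: base_chain_side.
- by left.
- rewrite (base_chain_heading n) /chain_heading /=.
  by case: (base_chain n).2; [left|right].
Qed.

Lemma basepointS n : d n <> char_c -> basepoint n.+1 = basepoint n.
Proof.
rewrite /basepoint /=; case: (base_chain n) => e b; case: (d n) => //= _.
  by rewrite subr0 at_coords_left mul0r mulrAC divff ?mul1r.
by rewrite at_coords_right mul0r subrK mulrAC divff ?mul1r.
Qed.

Context (param01 : forall n, 0 < shifted_param n < 1).

(** Each digit c prolongs the segment from the base point to the initial one by a
    piece crossing the new triangle; that piece is in the region left free by
    the next polygon, and the earlier ones are protected by [fillS]. *)
Lemma basepoint_chord n : exists t : R,
  [/\ t <= 0, basepoint n = basepoint 0%N + t *: direction (pi / 3) &
    forall r, t < r < 0 -> fill n (basepoint 0%N + r *: direction (pi / 3))].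
Proof.
elim: n => [|n [t [t0 xE inside]]].
  exists 0; split; rewrite ?scale0r ?addr0// => r r0.
  by exfalso; lra.
have [dc|dnc] : d n = char_c \/ d n <> char_c by case: (d n); [right|left|right].
  have [en hE] := (base_chain_side n, base_chain_heading n).
  have pe := proper_side_KS _ _ en.
  have := param01 n.+1; move: (hE) xE; rewrite /= dc /basepoint /=.
  rewrite dc /chain_heading; move: en pe {hE}.
  case: (base_chain n) => e b /= en pe hE xE p01.
  set u := shifted_param n in xE p01 *.
  have x0 := expr3_gt0 (R := R) n.
  pose tau := (if b then u - 1 / 3 else 2 / 3 - u) / 3 ^+ n.
  have tau0 : 0 < tau by rewrite divr_gt0//; case: (b) => /=; lra.
  have tauE : tau * 3 ^+ n = if b then u - 1 / 3 else 2 / 3 - u.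
    by rewrite /tau divfK// gt_eqF.
  (* In the frame of e the backward ray from (u, 0) leaves the new triangle at
     (1/3, u - 1/3) or (u, 2/3 - u), according to its direction; tau is the
     length of that piece. *)
  have shift (a : R) : basepoint 0%N + (t + a) *: direction (pi / 3) =
      at_coords e (u + a * 3 ^+ n * (if b then 1 else 0)) (- (a * 3 ^+ n)).
    rewrite scalerDl addrA -xE {1}hE at_coords_heading.
    by congr at_coords; ring.
  exists (t - tau); split; first by lra.
  - rewrite shift mulNr tauE; case: (b); rewrite ?at_coords_down ?at_coords_up;
      by congr at_coords; field.
  - move=> r /andP[tr r0]; have [rt|rt] := ltP t r.
      by apply: fillS; apply: inside; rewrite rt.
    pose a := r - t; have ra : r = t + a by rewrite /a addrC subrK.
    have hb : half_open_bump e (basepoint 0%N + r *: direction (pi / 3)).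
      rewrite ra shift /half_open_bump along_at_coords// aside_at_coords//.
      have : - (tau * 3 ^+ n) < a * 3 ^+ n by rewrite -mulNr ltr_pM2r//; rewrite /a; lra.
      have : a * 3 ^+ n <= 0 by rewrite pmulr_lle0//; rewrite /a; lra.
      rewrite tauE; move: (a * _) => y; case: (b); lra.
    split; last exact: half_open_bump_notin_KS en hb.
    by right; exists e => //; move: hb; rewrite /half_open_bump /koch_bump; lra.
exists t; split=> //; first by rewrite basepointS.
by move=> r tr; apply: fillS; exact: inside.
Qed.

Lemma basepoints_compatible : compatible_basepoints (pi / 3) basepoint.
Proof.
move=> n; have sn := basepoint_state n.
have [Kn _ inn] := koch_state_phase _ _ _ (param01 n) sn.
have [t [t0 xE inside]] := basepoint_chord n.
split=> //; first by exists t.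
move=> y [[l /=]]; rewrite in_itv /= => /andP[l0 l1] yE nends.
have {}yE : y = basepoint 0%N + ((1 - l) * t) *: direction (pi / 3).
  rewrite -yE xE opprD addrA subrr sub0r scalerN scalerA -addrA -scalerBl.
  by congr (_ + _ *: _); ring.
have l0' : l != 0.
  apply/eqP => l0'; apply: nends; left; rewrite yE l0' subr0 mul1r.
  by rewrite -xE.
have l1' : l != 1.
  apply/eqP => l1'; apply: nends; right.
  by rewrite yE l1' subrr mul0r scale0r addr0.
have t0' : t != 0.
  apply/eqP => t0'; apply: nends; right.
  by rewrite yE t0' mulr0 scale0r addr0.
have {}l0 : 0 < l by rewrite lt_neqAle eq_sym l0'.
have {}l1 : l < 1 by rewrite lt_neqAle l1'.
have {}t0 : t < 0 by rewrite lt_neqAle t0'.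
have [|_] := inside ((1 - l) * t); first by nra.
by rewrite yE.
Qed.

Lemma basepoints_periodic n : periodic_orbit n (basepoint n, direction (pi / 3)).
Proof. exact: koch_state_periodic (param01 n) (basepoint_state n). Qed.

Lemma basepoints_eventually_constant N :
  (forall n, (N <= n)%N -> d n <> char_c) -> eventually_constant (pi / 3) basepoint.
Proof.
move=> HN; exists N => n; elim: n => [|n IH]; first by rewrite leqn0 => /eqP ->.
rewrite leq_eqVlt => /predU1P[->//|]; rewrite ltnS => Nn; rewrite -IH//.
have dn := HN n Nn; rewrite basepointS//.
apply: billiard_orbit_refine (param01 n) (param01 n.+1) _ (basepoint_state n).
by rewrite /=; case: (d n) dn => //= _; [left; rewrite subr0|right].
Qed.
End Basepoints.

(** * Ternary expansions *)

Section Ternary.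
Context {R : realType} (s : R) (d : nat -> ternary_char).

Lemma finite_nat_bounded (A : set nat) :
  finite_set A -> exists N, forall k, A k -> (k < N)%N.
Proof.
move=> /finite_seqP[l ->]; exists (\max_(i <- l) i).+1 => k kl.
by rewrite ltnS; apply: leq_bigmax_seq.
Qed.

Lemma infinite_nat_unbounded (A : set nat) :
  infinite_set A -> forall n, exists2 k, (n <= k)%N & A k.
Proof.
move=> iA n; apply: contrapT => h; apply: iA.
apply: (@sub_finite_set _ _ `I_n); last exact: finite_II.
by move=> k Ak /=; rewrite ltnNge; apply/negP => nk; apply: h; exists k.
Qed.

Let S := series (fun k : nat => (digit (d k))%:R / 3 ^+ k.+1 : R).

Let seriesE n : S n.+1 = S n + (digit (d n))%:R / 3 ^+ n.+1.
Proof. by rewrite /S /series /= big_nat_recr. Qed.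

Lemma shifted_paramE n : shifted_param s d n = 3 ^+ n * (s - S n).
Proof.
elim: n => [|n IH]; first by rewrite /S /series /= big_geq// subr0 mul1r.
rewrite /= IH seriesE exprS; move: (S n) (3 ^+ n : R) (expr3_neq0 (R := R) n).
by move=> a x x0; field.
Qed.

Context (repr : ternary_representation d s).
Context (inf_l : infinite_set [set k | d k = char_l]).
Context (inf_r : infinite_set [set k | d k = char_r]).

(** The partial sums increase to [s], strictly at each digit r, while the partial
    sums with an added 3^-n decrease, strictly at each digit l, and bound [s]
    from above. *)
Lemma shifted_param01 n : 0 < shifted_param s d n < 1.
Proof.
have p3 m : 0 < (3 ^+ m)^-1 :> R by rewrite invr_gt0 expr3_gt0.
have e3 m : (3 ^+ m.+1)^-1 = (3 ^+ m)^-1 / 3 :> R.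
  by rewrite exprSr invfM mulrC.
have dig m : 0 <= ((digit (d m))%:R : R) <= 2 by case: (d m); rewrite ler0n ler_nat.
have incr : {homo S : a b / (a <= b)%N >-> a <= b}.
  apply: homo_leq => // [y x z|m]; first exact: le_trans.
  by rewrite seriesE lerDl divr_ge0// exprn_ge0.
have decr : {homo (fun m => S m + (3 ^+ m)^-1) : a b / (a <= b)%N >-> b <= a}.
  apply: homo_leq => // [y x z xy yz|m]; first exact: le_trans yz xy.
  rewrite seriesE e3; have := dig m; have := p3 m; nra.
have cvS : cvgn S by apply/cvg_ex; exists s.
have limS : limn S = s by exact: cvg_lim.
have s_ge m : S m <= s by rewrite -limS; exact: nondecreasing_cvgn_le.
have s_le m : s <= S m + (3 ^+ m)^-1.
  rewrite -limS; apply: limr_le => //; near=> k.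
  apply: le_trans (decr m k _); first by rewrite lerDl ltW.
  by near: k; exact: nbhs_infty_ge.
rewrite shifted_paramE pmulr_rgt0 ?expr3_gt0// subr_gt0.
rewrite mulrC -ltr_pdivlMr ?expr3_gt0// mul1r ltrBlDl.
apply/andP; split.
  have [k nk /= dk] := infinite_nat_unbounded _ inf_r n.
  apply: lt_le_trans (s_ge k.+1); apply: le_lt_trans (incr _ _ nk) _.
  by rewrite seriesE dk ltrDl divr_gt0// expr3_gt0.
have [k nk /= dk] := infinite_nat_unbounded _ inf_l n.
apply: le_lt_trans (s_le k.+1) _; apply: lt_le_trans (decr _ _ nk).
by rewrite seriesE dk mul0r addr0 ltrD2l e3; have := p3 k; lra.
Unshelve. all: by end_near. Qed.
End Ternary.

Theorem theorem5p7 (R : realType) (s : R) (d : nat -> ternary_char) :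
  0 <= s <= 1 ->
  ternary_representation d s ->
  finite_set [set k | d k = char_c] ->
  infinite_set [set k | d k = char_l] ->
  infinite_set [set k | d k = char_r] ->
  exists x : nat -> R * R,
    [/\ x 0%N = (s, 0),
        compatible_periodic_orbits (pi / 3) x &
        eventually_constant (pi / 3) x].
Proof.
move=> _ repr /finite_nat_bounded[N HN] inf_l inf_r.
have param01 := shifted_param01 s d repr inf_l inf_r.
exists (basepoint s d); split.
- rewrite /basepoint /at_coords /side_vec /rotate_cw /= !scaler_pairE /=.
  by congr pair => /=; ring.
- split; first exact: basepoints_compatible.
  exact: basepoints_periodic.
- apply: (basepoints_eventually_constant _ _ param01 N) => n Nn dn.
  by have := HN n dn; rewrite ltnNge Nn.
Qed.
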